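(* For every $r>1$, there exist two universal $r$-idempotents (acting on Hilbert spaces) that are not unitarily equivalent.
   Context: An idempotent $Q$ in a $C^*$-algebra satisfies $Q^2=Q$; a projection is a self-adjoint idempotent; a non-projection idempotent is an idempotent that is not a projection. $C^*\{Q\}$ is the $C^*$-algebra generated by $Q$ alone (not assumed to contain a unit of the ambient algebra). Universal $r$-idempotent ($r>1$): a non-projection idempotent $Q$ in a $C^*$-algebra such that $\|Q\|=r$ and for every non-projection idempotent $Q'$ in any $C^*$-algebra with $\|Q'\|\le r$ there is a $C^*$-algebra homomorphism ($*$-homomorphism) $\pi:C^*\{Q\}\to C^*\{Q'\}$ with $\pi(Q)=Q'$. Operators $Q_1\in\mathbb{B}(K_1)$ and $Q_2\in\mathbb{B}(K_2)$ on Hilbert spaces are unitarily equivalent if there is a unitary $U:K_1\to K_2$ with $UQ_1=Q_2U$. The two universal $r$-idempotents are considered as operators on Hilbert spaces; a continuous function $f\in C[1,d]$ (with $d=\frac12(r+1)$) is identified with the multiplication operator by $f$ on $L^2[1,d]$, so that $M_2(C[1,d])\subseteq\mathbb{B}(L^2[1,d]\oplus L^2[1,d])$. *)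

(* Defs.v *)
From HB Require Import structures.
From mathcomp Require Import all_boot all_order all_algebra.
From mathcomp Require Import complex.
From mathcomp Require Import all_classical all_reals all_analysis.
From mathcomp Require Import ring lra.

Set Implicit Arguments.
Unset Strict Implicit.
Unset Printing Implicit Defensive.

Import Order.TTheory GRing.Theory Num.Theory.
Import numFieldNormedType.Exports.

Local Open Scope classical_set_scope.
Local Open Scope complex_scope.
Local Open Scope ring_scope.

(* Norms of normed spaces over R[i] take their values in R[i]; they are
   nonnegative reals, compared with r : R through r%:C. *)

(* No unit is assumed, so the product cannot be a MathComp ring product. *)
HB.mixin Record CompleteNormedModule_isCStarAlgebra (R : realType) A
    of CompleteNormedModule R[i] A := {
  cmul : A -> A -> A;
  cstar : A -> A;
  cmulA : associative cmul;
  cmulDl : left_distributive cmul +%R;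
  cmulDr : right_distributive cmul +%R;
  cmulZl : forall (l : R[i]) (a b : A), cmul (l *: a) b = l *: cmul a b;
  cmulZr : forall (l : R[i]) (a b : A), cmul a (l *: b) = l *: cmul a b;
  cstarK : involutive cstar;
  cstarD : {morph cstar : a b / a + b};
  cstarZ : forall (l : R[i]) (a : A), cstar (l *: a) = l^* *: cstar a;
  cstarM : forall a b : A, cstar (cmul a b) = cmul (cstar b) (cstar a);
  cnormM : forall a b : A, `|cmul a b| <= `|a| * `|b|;
  cnorm_star : forall a : A, `|cmul (cstar a) a| = `|a| ^+ 2
}.

#[short(type="cstarAlgType")]
HB.structure Definition CStarAlgebra (R : realType) :=
  {A of CompleteNormedModule R[i] A
      & CompleteNormedModule_isCStarAlgebra R A}.

(* The inner product is linear in its first argument. *)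
HB.mixin Record CompleteNormedModule_isHilbert (R : realType) K
    of CompleteNormedModule R[i] K := {
  inner : K -> K -> R[i];
  innerDl : forall x y z : K, inner (x + y) z = inner x z + inner y z;
  innerZl : forall (l : R[i]) (x y : K), inner (l *: x) y = l * inner x y;
  innerC : forall x y : K, inner y x = (inner x y)^*;
  inner_norm : forall x : K, inner x x = `|x| ^+ 2
}.

#[short(type="hilbertType")]
HB.structure Definition Hilbert (R : realType) :=
  {K of CompleteNormedModule R[i] K
      & CompleteNormedModule_isHilbert R K}.

Section RealNorm.
Variables (R : realType) (V : normedModType R[i]).
Implicit Types x y : V.

Definition rnorm x : R := complex.Re `|x|.

Lemma rnormE x : `|x| = (rnorm x)%:C.
Proof. by rewrite /rnorm RRe_real// normr_real. Qed.

Lemma rnorm_ge0 x : 0 <= rnorm x.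
Proof. by rewrite -ler0c -rnormE. Qed.

Lemma rnormD x y : rnorm (x + y) <= rnorm x + rnorm y.
Proof. by rewrite -lecR rmorphD /= -!rnormE ler_normD. Qed.

Lemma rnormN x : rnorm (- x) = rnorm x.
Proof. by rewrite /rnorm normrN. Qed.

Lemma rnorm_dist x y : rnorm (x - y) = rnorm (y - x).
Proof. by rewrite -opprB rnormN. Qed.

Lemma rnorm0 : rnorm (0 : V) = 0.
Proof. by rewrite /rnorm normr0. Qed.

Lemma rnorm0_eq0 x : rnorm x = 0 -> x = 0.
Proof. by move=> x0; apply/eqP; rewrite -normr_eq0 rnormE x0. Qed.

Lemma rnormZ (t : R) x : rnorm (t%:C *: x) = `|t| * rnorm x.
Proof.
apply: (@complexI R); rewrite rmorphM /= -!rnormE normrZ; congr (_ * _).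
by rewrite normc_def /= expr0n /= addr0 sqrtr_sqr.
Qed.

Lemma rcvgP {T} {F : set_system T} {FF : Filter F} (f : T -> V) (l : V) :
  f @ F --> l <->
  forall e : R, 0 < e -> \forall t \near F, rnorm (l - f t) < e.
Proof.
split=> [/cvgrPdist_lt fl e e0|fl].
  have /fl : 0 < e%:C by rewrite ltcR.
  by apply: filterS => t; rewrite rnormE ltcR.
apply/cvgrPdist_lt => e e0.
have ee : (complex.Re e)%:C = e by rewrite RRe_real// gtr0_real.
have /fl : 0 < complex.Re e by rewrite -ltcR ee.
by apply: filterS => t; rewrite -ltcR -rnormE ee.
Qed.

End RealNorm.

Section BoundedOperators.
Variables (R : realType) (K : hilbertType R).

Record bop := Bop {
  bop_fun :> K -> K;
  bop_linear : linear bop_fun;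
  bop_continuous : continuous bop_fun
}.

HB.instance Definition _ (T : bop) :=
  GRing.isLinear.Build R[i] K K _ (bop_fun T) (bop_linear T).

Lemma bopP (S T : bop) : (forall x, S x = T x) -> S = T.
Proof.
case: S T => [f fl fc] [g gl gc] /= /funext fg; subst g.
by congr Bop; exact: Prop_irrelevance.
Qed.

HB.instance Definition _ := gen_eqMixin bop.
HB.instance Definition _ := gen_choiceMixin bop.

Lemma bop_bounded (T : bop) :
  exists2 M : R, 0 <= M & forall x, rnorm (T x) <= M * rnorm x.
Proof.
have /linear_bounded_continuous /linear_boundedP /pinfty_ex_gt0[M M0 TM] :=
  @bop_continuous T.
have MM : (complex.Re M)%:C = M by rewrite RRe_real// gtr0_real.
exists (complex.Re M) => [|x]; first by rewrite -lecR MM ltW.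
by rewrite -lecR rmorphM /= MM -!rnormE; exact: TM.
Qed.

Lemma bounded_continuous (f : K -> K) (M : R) : linear f ->
  (forall x, rnorm (f x) <= M * rnorm x) -> continuous f.
Proof.
move=> fl fM x; apply/rcvgP => e e0.
pose f' : {linear K -> K} := HB.pack f (GRing.isLinear.Build R[i] K K _ f fl).
have fB y : f x - f y = f (x - y) by rewrite -[f]/(f' : K -> K) raddfB.
have M1 : 0 < `|M| + 1 by rewrite ltr_wpDl.
have : \forall y \near x, rnorm (x - y) < e / (`|M| + 1).
  have /rcvgP -/(_ _ (divr_gt0 e0 M1)) : y @[y --> x] --> x by exact: cvg_id.
  exact.
apply: filterS => y; rewrite ltr_pdivlMr// => xy.
rewrite fB (le_lt_trans (fM _))// (le_lt_trans _ xy)// mulrC.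
rewrite ler_wpM2l ?rnorm_ge0// (le_trans (ler_norm _))// lerDl//.
Qed.

Definition bop_bound (f : K -> K) (fl : linear f) (M : R)
    (fM : forall x, rnorm (f x) <= M * rnorm x) : bop :=
  Bop fl (bounded_continuous fl fM).

Fact bop0_linear : linear (fun _ : K => 0 : K).
Proof. by move=> l x y; rewrite scaler0 addr0. Qed.
Definition bop0 := Bop bop0_linear (fun x => cvg_cst _).

Fact bopN_linear (T : bop) : linear (fun x => - T x).
Proof. by move=> l x y; rewrite linearP opprD scalerN. Qed.
Fact bopN_continuous (T : bop) : continuous (fun x => - T x).
Proof. by move=> x; apply: cvgN; exact: bop_continuous. Qed.
Definition bopN T := Bop (bopN_linear T) (@bopN_continuous T).

Fact bopD_linear (S T : bop) : linear (fun x => S x + T x).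
Proof. by move=> l x y; rewrite !linearP scalerDr addrACA. Qed.
Fact bopD_continuous (S T : bop) : continuous (fun x => S x + T x).
Proof. by move=> x; apply: cvgD; exact: bop_continuous. Qed.
Definition bopD S T := Bop (bopD_linear S T) (@bopD_continuous S T).

Fact bopZ_linear (k : R[i]) (T : bop) : linear (fun x => k *: T x).
Proof.
by move=> l x y; rewrite linearP scalerDr !scalerA [k * l]mulrC.
Qed.
Fact bopZ_continuous (k : R[i]) (T : bop) : continuous (fun x => k *: T x).
Proof. by move=> x; apply: cvgZ; [exact: cvg_cst | exact: bop_continuous]. Qed.
Definition bopZ k T := Bop (bopZ_linear k T) (@bopZ_continuous k T).

Fact bopM_linear (S T : bop) : linear (S \o T).
Proof. by move=> l x y; rewrite /= !linearP. Qed.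
Fact bopM_continuous (S T : bop) : continuous (S \o T).
Proof. by move=> x; apply: continuous_comp; exact: bop_continuous. Qed.
Definition bopM S T := Bop (bopM_linear S T) (@bopM_continuous S T).

Fact bop_addA : associative bopD.
Proof. by move=> ? ? ?; apply: bopP => x /=; rewrite addrA. Qed.
Fact bop_addC : commutative bopD.
Proof. by move=> ? ?; apply: bopP => x /=; rewrite addrC. Qed.
Fact bop_add0 : left_id bop0 bopD.
Proof. by move=> ?; apply: bopP => x /=; rewrite add0r. Qed.
Fact bop_addN : left_inverse bop0 bopN bopD.
Proof. by move=> ?; apply: bopP => x /=; rewrite addNr. Qed.

HB.instance Definition _ :=
  GRing.isZmodule.Build bop bop_addA bop_addC bop_add0 bop_addN.

Fact bop_scaleA a b T : bopZ a (bopZ b T) = bopZ (a * b) T.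
Proof. by apply: bopP => x /=; rewrite scalerA. Qed.
Fact bop_scale1 : left_id 1 bopZ.
Proof. by move=> ?; apply: bopP => x /=; rewrite scale1r. Qed.
Fact bop_scaleDr : right_distributive bopZ +%R.
Proof. by move=> ? ? ?; apply: bopP => x /=; rewrite scalerDr. Qed.
Fact bop_scaleDl T : {morph bopZ^~ T : a b / a + b}.
Proof. by move=> ? ?; apply: bopP => x /=; rewrite scalerDl. Qed.

HB.instance Definition _ := GRing.Zmodule_isLmodule.Build R[i] bop
  bop_scaleA bop_scale1 bop_scaleDr bop_scaleDl.

Lemma bopDE (S T : bop) x : (S + T) x = S x + T x. Proof. by []. Qed.
Lemma bopNE (T : bop) x : (- T) x = - T x. Proof. by []. Qed.
Lemma bopZE k (T : bop) x : (k *: T) x = k *: T x. Proof. by []. Qed.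

Definition opnorm (T : bop) : R :=
  sup [set rnorm (T x) | x in [set x : K | `|x| <= 1]].

Lemma has_sup_opnorm (T : bop) :
  has_sup [set rnorm (T x) | x in [set x : K | `|x| <= 1]].
Proof.
have [M M0 TM] := bop_bounded T; split.
  by exists (rnorm (T 0)), 0 => //=; rewrite normr0.
exists M => _ [x /= x1 <-]; rewrite (le_trans (TM x))// ler_piMr//.
by rewrite -lecR -rnormE.
Qed.

Lemma opnorm_ge0 T : 0 <= opnorm T.
Proof.
rewrite (le_trans (rnorm_ge0 (T 0)))//; apply: ub_le_sup.
  by case: (has_sup_opnorm T).
by exists 0 => //=; rewrite normr0.
Qed.

Lemma opnorm_apply (T : bop) x : rnorm (T x) <= opnorm T * rnorm x.
Proof.
have [->|x0] := eqVneq x 0; first by rewrite raddf0 !rnorm0 mulr0.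
have nx : 0 < rnorm x.
  rewrite lt_neqAle rnorm_ge0 andbT eq_sym; apply: contra_neq x0.
  exact: rnorm0_eq0.
rewrite -ler_pdivrMr//.
have -> : rnorm (T x) / rnorm x = rnorm (T ((rnorm x)^-1%:C *: x)).
  by rewrite linearZ /= rnormZ mulrC ger0_norm// invr_ge0 ltW.
apply: ub_le_sup; first by case: (has_sup_opnorm T).
exists ((rnorm x)^-1%:C *: x) => //=.
rewrite rnormE rnormZ ger0_norm ?invr_ge0 ?rnorm_ge0//.
by rewrite mulVf ?gt_eqF.
Qed.

Lemma opnorm_le (T : bop) (M : R) : 0 <= M ->
  (forall x, rnorm (T x) <= M * rnorm x) -> opnorm T <= M.
Proof.
move=> M0 TM; apply: ge_sup; first by case: (has_sup_opnorm T).
move=> _ [x /= x1 <-]; rewrite (le_trans (TM x))// ler_piMr//.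
by rewrite -lecR -rnormE.
Qed.

Fact opnormD (S T : bop) :
  (opnorm (S + T))%:C <= (opnorm S)%:C + (opnorm T)%:C.
Proof.
rewrite -rmorphD /= lecR opnorm_le ?addr_ge0 ?opnorm_ge0// => x.
by rewrite bopDE (le_trans (rnormD _ _))// mulrDl lerD// opnorm_apply.
Qed.

Lemma rnormZc (k : R[i]) (x : K) : rnorm (k *: x) = complex.Re `|k| * rnorm x.
Proof.
apply: (@complexI R); rewrite rmorphM /= RRe_real ?normr_real//.
by rewrite -!rnormE normrZ.
Qed.

Lemma Re_norm_ge0 (k : R[i]) : 0 <= complex.Re `|k|.
Proof. by rewrite -ler0c RRe_real// normr_real. Qed.

Fact opnormZ_le (k : R[i]) (T : bop) : opnorm (k *: T) <= complex.Re `|k| * opnorm T.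
Proof.
apply: opnorm_le => [|x]; first by rewrite mulr_ge0 ?Re_norm_ge0 ?opnorm_ge0.
by rewrite bopZE rnormZc -mulrA ler_wpM2l ?Re_norm_ge0// opnorm_apply.
Qed.

Fact opnormZ (k : R[i]) (T : bop) :
  (opnorm (k *: T))%:C = `|k| * (opnorm T)%:C.
Proof.
have kk : `|k| = (complex.Re `|k|)%:C by rewrite RRe_real// normr_real.
rewrite kk -rmorphM; congr (_%:C).
apply/eqP; rewrite eq_le opnormZ_le andTb.
have [->|k0] := eqVneq k 0; first by rewrite normr0 mul0r opnorm_ge0.
have := opnormZ_le k^-1 (k *: T); rewrite scalerA mulVf// scale1r.
have k1 : 0 < complex.Re `|k| by rewrite -ltcR -kk normr_gt0.
have -> : complex.Re `|k^-1| = (complex.Re `|k|)^-1.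
  apply: (@complexI R); rewrite fmorphV RRe_real ?normr_real//.
  by rewrite normfV kk.
by rewrite mulrC ler_pdivlMr// mulrC.
Qed.

Fact opnorm0_eq0 (T : bop) : (opnorm T)%:C = 0 -> T = 0.
Proof.
move=> /complexI T0; apply: bopP => x; apply: rnorm0_eq0; apply/eqP.
rewrite eq_le rnorm_ge0 andbT (le_trans (opnorm_apply T x))//.
by rewrite T0 mul0r.
Qed.

HB.instance Definition _ :=
  Lmodule_isNormed.Build R[i] bop opnormD opnormZ opnorm0_eq0.

Lemma bop_normE (T : bop) : `|T| = (opnorm T)%:C.
Proof. by []. Qed.

Lemma bop_rnormE (T : bop) : rnorm T = opnorm T.
Proof. by apply: (@complexI R); rewrite -rnormE. Qed.

End BoundedOperators.

Section Completeness.
Variables (R : realType) (K : hilbertType R).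

Lemma rcauchyP (V : normedModType R[i]) (F : set_system V) :
  ProperFilter F ->
  cauchy F <-> forall e : R, 0 < e ->
    exists x : V, \forall y \near F, rnorm (x - y) < e.
Proof.
move=> FF; split=> [/cauchyP Fc e e0|Fc].
  have /Fc[x Fx] : 0 < e%:C by rewrite ltcR.
  exists x; apply: filterS Fx => y.
  by rewrite -ball_normE /= rnormE ltcR.
apply/cauchyP => e e0.
have ee : (complex.Re e)%:C = e by rewrite RRe_real// gtr0_real.
have /Fc[x Fx] : 0 < complex.Re e by rewrite -ltcR ee.
exists x; apply: filterS Fx => y.
by rewrite -ball_normE /= rnormE -ltcR ee.
Qed.

Lemma bop_complete (F : set_system (bop K)) :
  ProperFilter F -> cauchy F -> cvg F.
Proof.
move=> FF /rcauchyP Fc.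
have Fx x : cvg ((fun T : bop K => T x) @ F).
  apply: cauchy_cvg; apply/rcauchyP => e e0.
  have x1 : 0 < rnorm x + 1 by rewrite ltr_wpDl ?rnorm_ge0.
  have [S FS] := Fc _ (divr_gt0 e0 x1).
  exists (S x); apply: filterS FS => T /=.
  rewrite bop_rnormE ltr_pdivlMr// => ST.
  rewrite -bopNE -bopDE (le_lt_trans (opnorm_apply _ _))//.
  by rewrite (le_lt_trans _ ST)// ler_wpM2l ?opnorm_ge0// lerDl.
pose L x := lim ((fun T : bop K => T x) @ F).
have cL x : (fun T : bop K => T x) @ F --> L x by exact: Fx.
have Ll : linear L.
  move=> l x y; apply: (@cvg_lim _ _ _ F) => //.
  under eq_fun do rewrite linearP.
  by apply: (cvgD _ (cL y)); apply: cvgZl_tmp; exact: cL.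
have near_L (e : R) (S : bop K) : 0 < e ->
    (\forall T \near F, rnorm (S - T) < e) ->
    forall x, rnorm (S x - L x) <= e * rnorm x.
  move=> e0 FS x; apply/ler_addgt0Pr => d d0.
  have /rcvgP/(_ _ d0) FT := cL x.
  have [T [ST LT]] : exists T : bop K, rnorm (S - T) < e /\
      rnorm (L x - T x) < d.
    by apply: (@filter_ex _ F); apply: filterI.
  rewrite -(subrKA (T x)) (le_trans (rnormD _ _))// lerD//; last first.
    by rewrite rnorm_dist ltW.
  rewrite -bopNE -bopDE (le_trans (opnorm_apply _ _))//.
  by rewrite ler_wpM2r ?rnorm_ge0// -bop_rnormE ltW.
have [S1 FS1] := Fc _ ltr01.
have Lb x : rnorm (L x) <= (1 + opnorm S1) * rnorm x.
  rewrite -[L x](subrK (S1 x)) (le_trans (rnormD _ _))// mulrDl lerD//.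
    by rewrite rnorm_dist near_L.
  exact: opnorm_apply.
pose T0 := bop_bound Ll Lb.
suff : F --> T0 by move=> FT0; apply/cvg_ex; exists T0.
apply/rcvgP => e e0.
have e2 : 0 < e / 2 by rewrite divr_gt0.
have [S FS] := Fc _ (divr_gt0 e2 (ltr0Sn _ 1)).
apply: filterS (FS) => T ST.
rewrite bop_rnormE (@le_lt_trans _ _ (e / 2))//; last by lra.
apply: opnorm_le => [|x]; first exact: ltW.
rewrite bopDE bopNE /= -(subrKA (S x)) (le_trans (rnormD _ _))//.
have -> : e / 2 * rnorm x = e / 2 / 2 * rnorm x + e / 2 / 2 * rnorm x by field.
rewrite lerD//; first by rewrite rnorm_dist near_L// divr_gt0.
rewrite -bopNE -bopDE (le_trans (opnorm_apply _ _))//.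
by rewrite ler_wpM2r ?rnorm_ge0// -bop_rnormE ltW.
Qed.

HB.instance Definition _ := Uniform_isComplete.Build (bop K) bop_complete.

End Completeness.

Section Riesz.
Variables (R : realType) (K : hilbertType R).
Implicit Types x y z : K.

Definition rinner x y : R := complex.Re (inner x y).

Lemma rinnerDl x y z : rinner (x + y) z = rinner x z + rinner y z.
Proof. by rewrite /rinner innerDl raddfD. Qed.

Lemma rinnerZl (t : R) x y : rinner (t%:C *: x) y = t * rinner x y.
Proof. by rewrite /rinner innerZl; case: inner => a b /=; ring. Qed.

Lemma rinnerC x y : rinner x y = rinner y x.
Proof. by rewrite /rinner (innerC x y); case: inner => a b. Qed.

Lemma rinnerxx x : rinner x x = rnorm x ^+ 2.
Proof.
by apply: (@complexI R); rewrite rmorphXn /= -rnormE -inner_norm /rinner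
  RRe_real// inner_norm realX// normr_real.
Qed.

Lemma rinnerDr x y z : rinner x (y + z) = rinner x y + rinner x z.
Proof. by rewrite rinnerC rinnerDl !(rinnerC x). Qed.

Lemma rinnerZr (t : R) x y : rinner x (t%:C *: y) = t * rinner x y.
Proof. by rewrite rinnerC rinnerZl rinnerC. Qed.

Lemma rinnerNl x y : rinner (- x) y = - rinner x y.
Proof. by have := rinnerZl (-1) x y; rewrite rmorphN scaleN1r mulN1r. Qed.

Lemma rinnerNr x y : rinner x (- y) = - rinner x y.
Proof. by rewrite rinnerC rinnerNl rinnerC. Qed.

Lemma rnorm_sqrD x y :
  rnorm (x + y) ^+ 2 = rnorm x ^+ 2 + 2 * rinner x y + rnorm y ^+ 2.
Proof. by rewrite -!rinnerxx !(rinnerDl, rinnerDr) (rinnerC y x); ring. Qed.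

Lemma rinner_le x y : rinner x y <= rnorm x * rnorm y.
Proof.
have [x0|x0] := eqVneq (rnorm x) 0.
  rewrite x0 mul0r (rnorm0_eq0 x0).
  by rewrite /rinner -(scale0r (0 : K)) innerZl mul0r.
have [y0|y0] := eqVneq (rnorm y) 0.
  rewrite y0 mulr0 (rnorm0_eq0 y0) rinnerC.
  by rewrite /rinner -(scale0r (0 : K)) innerZl mul0r.
have nx : 0 < rnorm x by rewrite lt_neqAle eq_sym x0 rnorm_ge0.
have ny : 0 < rnorm y by rewrite lt_neqAle eq_sym y0 rnorm_ge0.
have := sqr_ge0 (rnorm ((rnorm y)%:C *: x + - ((rnorm x)%:C *: y))).
rewrite rnorm_sqrD rnormN !rnormZ !ger0_norm ?rnorm_ge0//.
rewrite rinnerNr rinnerZl rinnerZr.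
have nxy : 0 < rnorm x * rnorm y by rewrite mulr_gt0.
move=> h; rewrite -subr_ge0 -(pmulr_rge0 _ nxy); move: h.
set a := rnorm x; set b := rnorm y; set c := rinner x y.
by move=> h; lra.
Qed.

(* Riesz representation, by minimizing |x|^2 - 2 psi x *)
Lemma riesz_real (psi : K -> R) (M : R) : 0 <= M ->
  (forall x y, psi (x + y) = psi x + psi y) ->
  (forall (t : R) x, psi (t%:C *: x) = t * psi x) ->
  (forall x, psi x <= M * rnorm x) ->
  exists z, forall x, psi x = rinner x z.
Proof.
move=> M0 psiD psiZ psiM.
pose J x := rnorm x ^+ 2 - 2 * psi x.
have JD x y : J (x + y) = J x + 2 * rinner x y + rnorm y ^+ 2 - 2 * psi y.
  by rewrite /J rnorm_sqrD psiD; ring.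
have J_ge x : - M ^+ 2 <= J x.
  by rewrite /J; have := psiM x; have := sqr_ge0 (rnorm x - M); nra.
have infJ : has_inf (range J).
  by split; [exists (J 0), 0 | exists (- M ^+ 2) => _ [x _ <-]].
pose m := inf (range J).
have mJ x : m <= J x by apply: ge_inf; [case: infJ | exists x].
have exJ n : exists x, J x < m + n.+1%:R^-1.
  have [|_ [x _ <-] Jx] := @inf_adherent _ _ n.+1%:R^-1 _ infJ.
    by rewrite invr_gt0.
  by exists x.
pose u n := projT1 (cid (exJ n)).
have Ju n : J (u n) < m + n.+1%:R^-1 by rewrite /u; case: cid.
have par x y : rnorm (x - y) ^+ 2 <= 2 * (J x + J y - 2 * m).
  have := mJ ((2^-1)%:C *: (x + y)).
  rewrite /J psiZ rnormZ exprMn real_normK ?num_real// psiD.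
  by rewrite !rnorm_sqrD rnormN rinnerNr => h; lra.
have small (e : R) : 0 < e -> \forall n \near \oo, n.+1%:R^-1 < e :> R.
  by move=> e0; exact: near_infty_natSinv_lt (PosNum e0).
have cu : cvg (u @ \oo).
  apply: cauchy_cvg; apply/rcauchyP => e e0.
  have d0 : 0 < e ^+ 2 / 8 by rewrite divr_gt0 ?exprn_gt0.
  have [N _ Ns] := small _ d0.
  exists (u N).
  suff : \forall n \near \oo, rnorm (u N - u n) < e by [].
  exists N => //= n Nn.
  have nN : n.+1%:R^-1 < e ^+ 2 / 8 by exact: Ns.
  have NN := Ns N (leqnn N); rewrite /= in NN.
  rewrite -(@ltr_pXn2r _ 2) ?nnegrE ?rnorm_ge0 ?ltW//.
  rewrite (le_lt_trans (par _ _))//.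
  have := Ju N; have := Ju n; move: d0 NN nN.
  move: (N.+1%:R^-1) (n.+1%:R^-1) (J _) (J _) => *; lra.
pose z := lim (u @ \oo).
have uz : u @ \oo --> z by exact: cu.
have Jz : J z <= m.
  pose c := 5 + 2 * rnorm z + 2 * M.
  have c0 : 0 < c by rewrite /c; have := rnorm_ge0 z; lra.
  apply/ler_addgt0Pr => e e0.
  pose d := Num.min 1 (e / c).
  have d0 : 0 < d by rewrite lt_min ltr01 divr_gt0.
  have /rcvgP/(_ _ d0) zu := uz.
  have [n [zn un]] : exists n, rnorm (z - u n) < d /\ n.+1%:R^-1 < d.
    by apply: (@filter_ex _ \oo); apply: filterI => //; exact: small.
  have dc : d * c <= e by rewrite -ler_pdivlMr// ge_min lexx orbT.
  have d1 : d <= 1 by rewrite ge_min lexx.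
  have nu : rnorm (u n) <= rnorm z + d.
    rewrite -[u n](subrK z) (le_trans (rnormD _ _))// addrC lerD2l.
    by rewrite rnorm_dist ltW.
  have JE : J z = J (u n) + 2 * rinner (u n) (z - u n) +
      rnorm (z - u n) ^+ 2 - 2 * psi (z - u n).
    by rewrite -JD addrC subrK.
  have psiN : - psi (z - u n) <= M * rnorm (z - u n).
    have := psiM ((-1)%:C *: (z - u n)).
    by rewrite psiZ rnormZ normrN normr1; lra.
  have CS := rinner_le (u n) (z - u n).
  have := Ju n; rewrite JE; move: zn un dc nu psiN CS.
  have := rnorm_ge0 (z - u n); have := rnorm_ge0 (u n).
  have := rnorm_ge0 z; rewrite /c.
  set w := rnorm (z - u n); set v := rnorm (u n); set s := rnorm z.
  move=> s0 v0 w0 wd nd dc vs psiN CS Jun.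
  have h1 : v * w <= (s + d) * d by rewrite ler_pM// ltW.
  have h2 : w ^+ 2 <= d * d by rewrite expr2 ler_pM// ltW.
  have h3 : d * d <= d by rewrite ger_pMr.
  have h4 : M * w <= M * d by rewrite ler_wpM2l// ltW.
  move: nd Jun; move: (n.+1%:R^-1) => q nd Jun; lra.
exists z => x; apply/eqP; rewrite -subr_eq0; apply/eqP.
set a := psi x - rinner x z.
have h (t : R) : 0 <= t ^+ 2 * rnorm x ^+ 2 - 2 * t * a.
  have := le_trans Jz (mJ (z + t%:C *: x)).
  rewrite JD psiZ rnormZ exprMn real_normK ?num_real//.
  by rewrite rinnerZr (rinnerC z x) /a; lra.
pose s := rnorm x ^+ 2 + 1.
have s0 : 0 < s by rewrite ltr_wpDl ?sqr_ge0.
have := h (a / s).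
have -> : (a / s) ^+ 2 * rnorm x ^+ 2 - 2 * (a / s) * a =
    - (a ^+ 2 / s) * (1 + s^-1).
  have -> : rnorm x ^+ 2 = s - 1 by rewrite addrK.
  by clearbody s a; field; rewrite gt_eqF.
have s1 : 0 < 1 + s^-1 by rewrite ltr_wpDr ?invr_ge0 ?ltW.
rewrite pmulr_lge0// oppr_ge0 => ha.
apply/eqP; rewrite -sqrf_eq0; apply/eqP/le_anti; rewrite sqr_ge0 andbT.
by move: ha; rewrite pmulr_lle0 ?invr_gt0.
Qed.

Lemma Im_rinner x y : complex.Im (inner x y) = rinner (- 'i *: x) y.
Proof. by rewrite /rinner innerZl; case: inner => a b /=; ring. Qed.

Lemma inner_inj y z : (forall x, rinner x y = rinner x z) -> y = z.
Proof.
move=> yz; apply/eqP; rewrite -subr_eq0; apply/eqP/rnorm0_eq0/eqP.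
by rewrite -sqrf_eq0 -rinnerxx rinnerDr rinnerNr yz subrr.
Qed.

Lemma adjoint_ex (T : bop K) (y : K) :
  exists z, forall x, inner (T x) y = inner x z.
Proof.
have [||||z Tz] := @riesz_real (fun x => rinner (T x) y) (opnorm T * rnorm y).
- by rewrite mulr_ge0 ?opnorm_ge0 ?rnorm_ge0.
- by move=> x x'; rewrite raddfD rinnerDl.
- by move=> t x; rewrite linearZ rinnerZl.
- move=> x; rewrite (le_trans (rinner_le _ _))// mulrAC.
  by rewrite ler_wpM2r ?rnorm_ge0// opnorm_apply.
exists z => x; apply/eqP; rewrite eq_complex !Im_rinner -linearZ.
by rewrite -/(rinner _ _) -/(rinner x z) !Tz !eqxx.
Qed.

Definition adj_fun (T : bop K) (y : K) : K := projT1 (cid (adjoint_ex T y)).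

Lemma adj_funP (T : bop K) x y : inner (T x) y = inner x (adj_fun T y).
Proof. by rewrite /adj_fun; case: cid. Qed.

Lemma innerDr x y z : inner x (y + z) = inner x y + inner x z.
Proof. by rewrite innerC innerDl rmorphD /= -!innerC. Qed.

Lemma innerZr (l : R[i]) x y : inner x (l *: y) = l^* * inner x y.
Proof. by rewrite innerC innerZl rmorphM /= -innerC. Qed.

Fact adj_linear (T : bop K) : linear (adj_fun T).
Proof.
move=> l y z; apply: inner_inj => x; rewrite /rinner.
by rewrite -adj_funP !innerDr !innerZr -!adj_funP.
Qed.

Fact adj_bound (T : bop K) y : rnorm (adj_fun T y) <= opnorm T * rnorm y.
Proof.
have [->|n0] := eqVneq (rnorm (adj_fun T y)) 0.
  by rewrite mulr_ge0 ?opnorm_ge0 ?rnorm_ge0.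
have n1 : 0 < rnorm (adj_fun T y) by rewrite lt_neqAle eq_sym n0 rnorm_ge0.
rewrite -(ler_pM2l n1) -expr2 -rinnerxx {1}/rinner -adj_funP -/(rinner _ _).
rewrite (le_trans (rinner_le _ _))// mulrCA mulrA.
by rewrite ler_wpM2r ?rnorm_ge0// opnorm_apply.
Qed.

Definition bop_adj (T : bop K) : bop K :=
  bop_bound (adj_linear T) (@adj_bound T).

Lemma bop_adjP (T : bop K) x y : inner (T x) y = inner x (bop_adj T y).
Proof. exact: adj_funP. Qed.

Lemma bop_adj_uniq (S T : bop K) :
  (forall x y, inner (T x) y = inner x (S y)) -> bop_adj T = S.
Proof.
move=> TS; apply: bopP => y; apply: inner_inj => x.
by rewrite /rinner -bop_adjP TS.
Qed.

Fact bop_adjK : involutive bop_adj.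
Proof.
move=> T; apply: bop_adj_uniq => x y.
by rewrite innerC -bop_adjP -innerC.
Qed.

Fact bop_adjD : {morph bop_adj : S T / S + T}.
Proof.
move=> S T; apply: bop_adj_uniq => x y.
by rewrite !bopDE innerDl innerDr !bop_adjP.
Qed.

Fact bop_adjZ (l : R[i]) (T : bop K) : bop_adj (l *: T) = l^* *: bop_adj T.
Proof.
apply: bop_adj_uniq => x y.
by rewrite !bopZE innerZl innerZr conjCK bop_adjP.
Qed.

Fact bop_adjM (S T : bop K) : bop_adj (bopM S T) = bopM (bop_adj T) (bop_adj S).
Proof. by apply: bop_adj_uniq => x y /=; rewrite !bop_adjP. Qed.

Fact bop_mulA : associative (@bopM R K).
Proof. by move=> ? ? ?; exact: bopP. Qed.

Fact bop_mulDl : left_distributive (@bopM R K) +%R.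
Proof. by move=> ? ? ?; exact: bopP. Qed.

Fact bop_mulDr : right_distributive (@bopM R K) +%R.
Proof. by move=> S ? ?; apply: bopP => x; rewrite /= raddfD. Qed.

Fact bop_mulZl (l : R[i]) (S T : bop K) : bopM (l *: S) T = l *: bopM S T.
Proof. exact: bopP. Qed.

Fact bop_mulZr (l : R[i]) (S T : bop K) : bopM S (l *: T) = l *: bopM S T.
Proof. by apply: bopP => x; rewrite /= linearZ. Qed.

Lemma opnormM (S T : bop K) : opnorm (bopM S T) <= opnorm S * opnorm T.
Proof.
apply: opnorm_le => [|x]; first by rewrite mulr_ge0 ?opnorm_ge0.
rewrite /= (le_trans (opnorm_apply _ _))// -mulrA.
by rewrite ler_wpM2l ?opnorm_ge0// opnorm_apply.
Qed.

Fact bop_normM (S T : bop K) : `|bopM S T| <= `|S| * `|T|.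
Proof. by rewrite !bop_normE -rmorphM lecR opnormM. Qed.

Fact bop_norm_star (T : bop K) : `|bopM (bop_adj T) T| = `|T| ^+ 2.
Proof.
rewrite !bop_normE -rmorphXn; congr (_%:C); apply/eqP; rewrite eq_le.
have adj_le : opnorm (bop_adj T) <= opnorm T.
  by apply: opnorm_le (opnorm_ge0 T) _ => y; exact: adj_bound.
rewrite (le_trans (opnormM _ _)) /=; last first.
  by rewrite expr2 ler_wpM2r ?opnorm_ge0.
set N := opnorm (bopM _ _).
have N0 : 0 <= N by exact: opnorm_ge0.
rewrite -(sqr_sqrtr N0) ler_pXn2r ?nnegrE ?sqrtr_ge0 ?opnorm_ge0//.
apply: opnorm_le => [|x]; first exact: sqrtr_ge0.
rewrite -(@ler_pXn2r _ 2) ?nnegrE ?mulr_ge0 ?sqrtr_ge0 ?rnorm_ge0//.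
rewrite exprMn sqr_sqrtr// -[leLHS]rinnerxx /rinner bop_adjP -/(rinner _ _).
rewrite (le_trans (rinner_le _ _))// mulrC expr2 mulrA.
by rewrite ler_wpM2r ?rnorm_ge0// (opnorm_apply (bopM (bop_adj T) T)).
Qed.

HB.instance Definition _ :=
  CompleteNormedModule_isCStarAlgebra.Build R (bop K)
    bop_mulA bop_mulDl bop_mulDr bop_mulZl bop_mulZr
    bop_adjK bop_adjD bop_adjZ bop_adjM bop_normM bop_norm_star.

End Riesz.

Notation "''B' ( K )" := (bop K) (at level 8, format "''B' ( K )").

Section Universal.
Variable R : realType.

Definition idempotent_elt (A : cstarAlgType R) (Q : A) := cmul Q Q = Q.

Definition projection_elt (A : cstarAlgType R) (Q : A) :=
  idempotent_elt Q /\ cstar Q = Q.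

Definition nonprojection_idempotent (A : cstarAlgType R) (Q : A) :=
  idempotent_elt Q /\ ~ projection_elt Q.

Definition cstar_subalgebra (A : cstarAlgType R) (S : set A) :=
  [/\ S 0,
      forall (l : R[i]) (a b : A), S a -> S b -> S (l *: a + b),
      forall a b : A, S a -> S b -> S (cmul a b),
      forall a : A, S a -> S (cstar a)
    & closed S].

Definition cstar_generated (A : cstarAlgType R) (Q : A) : set A :=
  smallest (@cstar_subalgebra A) [set Q].

(* A map between C*-subalgebras S of A and S' of B is represented by a
   function A -> B whose values outside S are irrelevant. *)
Definition star_homomorphism (A B : cstarAlgType R) (S : set A) (S' : set B)
    (pi : A -> B) :=
  [/\ set_fun S S' pi,
      forall (l : R[i]) (a b : A), S a -> S b ->
        pi (l *: a + b) = l *: pi a + pi b,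
      forall a b : A, S a -> S b -> pi (cmul a b) = cmul (pi a) (pi b)
    & forall a : A, S a -> pi (cstar a) = cstar (pi a)].

Definition universal_idempotent (r : R) (A : cstarAlgType R) (Q : A) :=
  [/\ nonprojection_idempotent Q,
      `|Q| = r%:C
    & forall (A' : cstarAlgType R) (Q' : A'),
        nonprojection_idempotent Q' -> `|Q'| <= r%:C ->
        exists2 pi : A -> A',
          star_homomorphism (cstar_generated Q) (cstar_generated Q') pi
          & pi Q = Q'].

Definition unitary (K1 K2 : hilbertType R) (U : {linear K1 -> K2}) :=
  bijective U /\ forall x y : K1, inner (U x) (U y) = inner x y.

Definition unitarily_equivalent (K1 K2 : hilbertType R)
    (Q1 : 'B(K1)) (Q2 : 'B(K2)) :=
  exists2 U : {linear K1 -> K2}, unitary U & forall x, U (Q1 x) = Q2 (U x).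

End Universal.

(* Main.v *)
(** Let Q be the direct sum over n of the 2x2 matrices [[1, t_n], [0, 0]] on
    l^2(nat; C^2), where (t_n) is dense in [0, s] and s^2 = r^2 - 1.  Two choices
    of (t_n), one avoiding 0 and one with t_0 = 0, are not unitarily equivalent:
    only in the second case is there a nonzero vector in the kernel of Q
    orthogonal to its range.

    For universality, the point is that |p(q)| <= |p(Q)| for every
    *-polynomial p and every idempotent q with |q| <= r in a C*-algebra; pi is
    then obtained by continuity.  The element h = -(q - q')^2 = k^2, with
    q' the adjoint of q and k = -i(q - q') self-adjoint, commutes with q and q',
    and q q' q = (1 + h) q.  So every *-polynomial in q is a combination of
    q, q', q q', q' q whose coefficients are polynomials in h not depending on
    q.  Writing k/s' as the real part of a unitary u (in the unitization, for
    s' > |k|) turns f(h) into a Laurent polynomial in u^2 whose coefficients are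
    at most sup |f| over [0, s'^2], so |f(h)| <= (2 deg f + 1) sup |f|.  Since
    |k|^2 <= r^2 - 1, while each t_n^2 is an eigenvalue of the element h of Q,
    this bounds |p(q)| by |p(Q)| up to a constant; applying it to high powers of
    p' p, whose degrees grow only linearly, the C*-identity removes the
    constant. *)

Require Import Defs.
From HB Require Import structures.
From mathcomp Require Import all_boot all_order all_algebra ssrAC.
From mathcomp Require Import complex.
From mathcomp Require Import all_classical all_reals all_analysis.
From mathcomp Require Import ring lra zify.
Set Implicit Arguments.
Unset Strict Implicit.
Unset Printing Implicit Defensive.
Import Order.TTheory GRing.Theory Num.Theory.
Import numFieldNormedType.Exports.
Local Open Scope classical_set_scope.
Local Open Scope complex_scope.
Local Open Scope ring_scope.

(** * Unitization of a C*-algebra without unit *)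

Section CStarNorm.
Variable R : realType.

Lemma conj_realC (x : R) : (x%:C)^* = x%:C.
Proof. exact: conjc_real. Qed.

Lemma rnormZC (V : normedModType R[i]) (l : R[i]) (x : V) :
  rnorm (l *: x) = rnorm (l : R[i]^o) * rnorm x.
Proof. by apply: (@complexI R); rewrite rmorphM /= -!rnormE normrZ. Qed.

Lemma normcE_rnorm (z : R[i]) : `|z| = (rnorm (z : R[i]^o))%:C.
Proof. exact: (@rnormE R R[i]^o). Qed.

Variable A : cstarAlgType R.
Implicit Types a b x : A.

Lemma rnormM a b : rnorm (cmul a b) <= rnorm a * rnorm b.
Proof. by rewrite -lecR rmorphM /= -!rnormE cnormM. Qed.

Lemma rnorm_star a : rnorm (cmul (cstar a) a) = rnorm a ^+ 2.
Proof. by apply: (@complexI R); rewrite rmorphXn /= -!rnormE cnorm_star. Qed.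

(** The C*-identity gives [|b|^2 <= |b^*| |b|], hence one inequality for every [b]; the reverse one
    is the same statement for the adjoint. *)
Lemma rnorm_cstar a : rnorm (cstar a) = rnorm a.
Proof.
have le b : rnorm b <= rnorm (cstar b).
  have [->|b0] := eqVneq (rnorm b) 0; first exact: rnorm_ge0.
  have b1 : 0 < rnorm b by rewrite lt_neqAle eq_sym b0 rnorm_ge0.
  by rewrite -(ler_pM2r b1) -expr2 -rnorm_star rnormM.
by apply/le_anti; rewrite le -{2}[a]cstarK le.
Qed.

Lemma cmul0r a : cmul 0 a = 0.
Proof. by rewrite -(scale0r (0 : A)) cmulZl !scale0r. Qed.
Lemma cmulr0 a : cmul a 0 = 0.
Proof. by rewrite -(scale0r (0 : A)) cmulZr !scale0r. Qed.
Lemma cmulNl a b : cmul (- a) b = - cmul a b.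
Proof. by rewrite -scaleN1r cmulZl scaleN1r. Qed.
Lemma cmulNr a b : cmul a (- b) = - cmul a b.
Proof. by rewrite -scaleN1r cmulZr scaleN1r. Qed.
Lemma cmulBl a b x : cmul (a - b) x = cmul a x - cmul b x.
Proof. by rewrite cmulDl cmulNl. Qed.
Lemma cmulBr a b x : cmul x (a - b) = cmul x a - cmul x b.
Proof. by rewrite cmulDr cmulNr. Qed.
Lemma cstarN a : cstar (- a) = - cstar a.
Proof. by rewrite -scaleN1r cstarZ rmorphN1 scaleN1r. Qed.
Lemma cstarB a b : cstar (a - b) = cstar a - cstar b.
Proof. by rewrite cstarD cstarN. Qed.

End CStarNorm.

Section Unitization.
Variables (R : realType) (A : cstarAlgType R).

(** Only the algebraic unitization, with neither norm nor involution. Its elements are measured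
    through their left action [act] on [A], so no norm on the unitization has to be built. *)
Definition unitz : Type := (R[i]^o * A)%type.

HB.instance Definition _ := GRing.Lmodule.on unitz.

Definition unitz_one : unitz := (1, 0).
Definition unitz_mul (u v : unitz) : unitz :=
  (u.1 * v.1, u.1 *: v.2 + v.1 *: u.2 + cmul u.2 v.2).

Fact unitz_mulA : associative unitz_mul.
Proof.
move=> [a x] [b y] [c z]; rewrite /unitz_mul /=; congr pair; first exact: mulrA.
rewrite !scalerDr !cmulDl !cmulDr !scalerA !cmulZl !cmulZr cmulA !addrA.
rewrite [c * a]mulrC [c * b]mulrC.
by rewrite [LHS](ACl (1*2*4*6*3*5*7)).
Qed.
Fact unitz_mul1l : left_id unitz_one unitz_mul.
Proof.
by move=> [a x]; rewrite /unitz_mul /= mul1r scale1r scaler0 addr0 cmul0r addr0.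
Qed.
Fact unitz_mul1r : right_id unitz_one unitz_mul.
Proof.
by move=> [a x]; rewrite /unitz_mul /= mulr1 scale1r scaler0 add0r cmulr0 addr0.
Qed.
Fact unitz_mulDl : left_distributive unitz_mul +%R.
Proof.
move=> [a x] [b y] [c z]; rewrite /unitz_mul /=; congr pair => /=.
  exact: mulrDl.
by rewrite scalerDl scalerDr cmulDl !addrA [LHS](ACl (1*3*5*2*4*6)).
Qed.
Fact unitz_mulDr : right_distributive unitz_mul +%R.
Proof.
move=> [a x] [b y] [c z]; rewrite /unitz_mul /=; congr pair => /=.
  exact: mulrDr.
by rewrite scalerDl scalerDr cmulDr !addrA [LHS](ACl (1*3*5*2*4*6)).
Qed.
Fact unitz_neq0 : unitz_one != 0.
Proof. by apply/eqP => -[/eqP]; rewrite oner_eq0. Qed.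

HB.instance Definition _ := GRing.Zmodule_isNzRing.Build unitz
  unitz_mulA unitz_mul1l unitz_mul1r unitz_mulDl unitz_mulDr unitz_neq0.

Fact unitz_scaleAl (l : R[i]) (u v : unitz) : l *: (u * v) = (l *: u) * v.
Proof.
case: u v => [a x] [b y]; congr pair => /=; first exact: mulrA.
by rewrite !scalerDr !scalerA cmulZl [b * l]mulrC.
Qed.
Fact unitz_scaleAr (l : R[i]) (u v : unitz) : l *: (u * v) = u * (l *: v).
Proof.
case: u v => [a x] [b y]; congr pair => /=; first exact: mulrCA.
by rewrite !scalerDr !scalerA cmulZr [a * l]mulrC.
Qed.
HB.instance Definition _ := GRing.Lmodule_isLalgebra.Build R[i] unitz unitz_scaleAl.
HB.instance Definition _ := GRing.Lalgebra_isAlgebra.Build R[i] unitz unitz_scaleAr.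

Definition inA (a : A) : unitz := (0, a).

Fact inA_linear : linear inA.
Proof. by move=> l a b; congr pair; rewrite /= scaler0 addr0. Qed.
HB.instance Definition _ := GRing.isLinear.Build R[i] A unitz _ inA inA_linear.

Lemma inAD a b : inA (a + b) = inA a + inA b. Proof. exact: raddfD. Qed.
Lemma inAZ l a : inA (l *: a) = l *: inA a. Proof. exact: linearZ. Qed.
Lemma inAB a b : inA (a - b) = inA a - inA b. Proof. exact: raddfB. Qed.
Lemma inAM a b : inA (cmul a b) = inA a * inA b.
Proof. by congr pair => /=; rewrite ?mulr0// !scale0r !add0r. Qed.

Lemma inA_inj : injective inA. Proof. by move=> a b []. Qed.

Definition act (u : unitz) (x : A) : A := u.1 *: x + cmul u.2 x.

Lemma inA_act u x : inA (act u x) = u * inA x.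
Proof. by case: u => a y; congr pair; rewrite /= ?mulr0// scale0r addr0. Qed.

Lemma actM u v x : act (u * v) x = act u (act v x).
Proof. by apply: inA_inj; rewrite !inA_act mulrA. Qed.
Lemma act1 x : act 1 x = x.
Proof. by apply: inA_inj; rewrite inA_act mul1r. Qed.
Lemma actDl u v x : act (u + v) x = act u x + act v x.
Proof. by apply: inA_inj; rewrite inAD !inA_act mulrDl. Qed.
Lemma actZl l u x : act (l *: u) x = l *: act u x.
Proof. by apply: inA_inj; rewrite inAZ !inA_act scalerAl. Qed.
Lemma act_suml (I : Type) (s : seq I) (P : pred I) (F : I -> unitz) x :
  act (\sum_(i <- s | P i) F i) x = \sum_(i <- s | P i) act (F i) x.
Proof.
by apply: inA_inj; rewrite inA_act mulr_suml raddf_sum; apply: eq_bigr => i _ /=; rewrite inA_act.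
Qed.
Lemma act_inA a x : act (inA a) x = cmul a x.
Proof. by apply: inA_inj; rewrite inA_act inAM. Qed.
Lemma act_cmul u x y : act u (cmul x y) = cmul (act u x) y.
Proof. by apply: inA_inj; rewrite inA_act !inAM inA_act mulrA. Qed.

Lemma comm_horner_alg (u v : unitz) (f : {poly R[i]}) :
  u * v = v * u -> horner_alg u f * v = v * horner_alg u f.
Proof.
move=> uv; elim/poly_ind: f => [|f c IH]; first by rewrite raddf0 mul0r mulr0.
rewrite !rmorphD !rmorphM /= horner_algX horner_algC mulrDl mulrDr.
by rewrite -mulrA uv !mulrA IH mulr_algl mulr_algr.
Qed.

End Unitization.

(** * Square roots and unitaries *)

Section SquareRoot.
Variables (R : realType) (A : cstarAlgType R).
Implicit Types a b w x y : A.

Lemma rnorm_small (V : normedModType R[i]) (x : V) (C : R) :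
  (forall e : R, 0 < e -> rnorm x <= C * e) -> x = 0.
Proof.
move=> h; apply: rnorm0_eq0; apply/le_anti; rewrite rnorm_ge0 andbT.
apply/ler_addgt0Pr => e e0; rewrite add0r.
have C1 : 0 < `|C| + 1 by rewrite ltr_wpDl.
rewrite (le_trans (h _ (divr_gt0 e0 C1)))// mulrA ler_pdivrMr// mulrC.
by rewrite (ler_wpM2l (ltW e0))// (le_trans (ler_norm _))// lerDl.
Qed.

Lemma rcvg_geometric (w : nat -> A) (c : R) : 0 <= c -> c < 1 ->
  (forall n, rnorm (w n.+1 - w n) <= c ^+ n) ->
  exists l : A, forall e : R, 0 < e ->
    exists N, forall n, (N <= n)%N -> rnorm (l - w n) < e.
Proof.
move=> c0 c1 wc.
have c1' : 0 < 1 - c by rewrite subr_gt0.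
(* Telescoping against the geometric series; the factor [1 - c] stays on the left to avoid a
   division. *)
have tel n d : rnorm (w n - w (n + d)%N) * (1 - c) <= c ^+ n - c ^+ (n + d).
  elim: d => [|d IH]; first by rewrite addn0 !subrr rnorm0 mul0r.
  rewrite addnS -(subrKA (w (n + d)%N)).
  have := rnormD (w n - w (n + d)%N) (w (n + d)%N - w (n + d).+1).
  have := wc (n + d)%N; rewrite rnorm_dist exprS.
  move: IH; move: (rnorm _) (rnorm _) (rnorm _) (c ^+ _) (c ^+ _) => *; nra.
have small (e : R) : 0 < e -> exists N, forall n, (N <= n)%N -> c ^+ n < e.
  move=> e0; have := @cvg_expr R c; rewrite ger0_norm// => /(_ c1).
  move=> /cvgrPdist_lt /(_ _ e0) [N _ Nn]; exists N => n /Nn.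
  by rewrite /= sub0r normrN ger0_norm// exprn_ge0.
have cw : cvg (w @ \oo).
  apply: cauchy_cvg; apply/rcauchyP => e e0.
  have [N Nn] := small _ (mulr_gt0 e0 c1').
  exists (w N); exists N => // n /= /subnKC <-.
  rewrite -(ltr_pM2r c1') (le_lt_trans (tel _ _))// (le_lt_trans _ (Nn _ (leqnn N)))//.
  by rewrite lerBlDr lerDl exprn_ge0.
exists (lim (w @ \oo)) => e e0.
by have /rcvgP/(_ _ e0)[N _ Nn] := cw; exists N => n /Nn.
Qed.

(** Visser's iteration for square roots: a fixed point [w = (a + w^2) / 2] satisfies
    [(1 - w)^2 = 1 - a]. Only [w], not [1 - w], is computed, so the iterates stay in [A]. *)
Fixpoint visser a n : A :=
  if n is n'.+1 then (2^-1 : R)%:C *: (a + cmul (visser a n') (visser a n'))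
  else 0.

Lemma half2C : (2^-1 : R)%:C * 2 = 1.
Proof. by rewrite -(rmorph_nat (@real_complex R)) -rmorphM /= mulVf. Qed.

Lemma visser_bound a (rho := rnorm a) n : rho < 1 ->
  rnorm (visser a n) <= (1 + rho) / 2.
Proof.
move=> rho1; have rho0 : 0 <= rho := rnorm_ge0 a.
elim: n => [|n IH] /=; first by rewrite rnorm0; lra.
rewrite rnormZ ger0_norm ?invr_ge0//.
have := rnormD a (cmul (visser a n) (visser a n)).
have := rnormM (visser a n) (visser a n).
have := rnorm_ge0 (visser a n).
rewrite -/rho; move: IH; move: (rnorm (_ + _)) (rnorm _) (rnorm _) => x y z; nra.
Qed.

(** With consecutive iterates [v] and [v'], [v v - v' v' = v (v - v') + (v - v') v']; both are
    bounded by [c < 1], so each step contracts by [c]. *)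
Lemma visser_dist a (c := (1 + rnorm a) / 2) n : rnorm a < 1 ->
  rnorm (visser a n.+1 - visser a n) <= c ^+ n.
Proof.
move=> rho1; have rho0 := rnorm_ge0 a.
elim: n => [|n IH].
  by rewrite /= cmul0r addr0 subr0 rnormZ ger0_norm ?invr_ge0// expr0; lra.
have -> : visser a n.+2 - visser a n.+1 = (2^-1 : R)%:C *:
    (cmul (visser a n.+1) (visser a n.+1 - visser a n) +
     cmul (visser a n.+1 - visser a n) (visser a n)).
  have := cmulBr (visser a n.+1) (visser a n) (visser a n.+1).
  have := cmulBl (visser a n.+1) (visser a n) (visser a n).
  move=> -> ->; rewrite subrKA [LHS]/= -scalerBr.
  by congr (_ *: _); rewrite opprD addrACA subrr add0r.
rewrite rnormZ ger0_norm ?invr_ge0//.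
have b1 := @visser_bound a n.+1 rho1; have b0 := @visser_bound a n rho1.
move: IH b0 b1; set d := visser a n.+1 - visser a n.
set v := visser a n.+1; set v' := visser a n => IH b0 b1.
have h := rnormD (cmul v d) (cmul d v').
have h1 := rnormM v d; have h2 := rnormM d v'.
have p1 := rnorm_ge0 d; have p2 := rnorm_ge0 v; have p3 := rnorm_ge0 v'.
rewrite exprS.
have q1 : rnorm v * rnorm d <= c * c ^+ n by rewrite ler_pM.
have q2 : rnorm d * rnorm v' <= c * c ^+ n by rewrite mulrC ler_pM.
lra.
Qed.

Lemma visser_comm a b n : cmul a b = cmul b a ->
  cmul (visser a n) b = cmul b (visser a n).
Proof.
move=> ab; elim: n => [|n IH] /=; first by rewrite cmul0r cmulr0.
by rewrite cmulZl cmulZr cmulDl cmulDr ab -cmulA IH cmulA IH cmulA.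
Qed.

Lemma visser_star a n : cstar a = a -> cstar (visser a n) = visser a n.
Proof.
move=> sa; elim: n => [|n IH] /=.
  by rewrite -(scale0r (0 : A)) cstarZ rmorph0 !scale0r.
by rewrite cstarZ conj_realC cstarD sa cstarM IH.
Qed.

(* [1 - w] is a square root of [1 - a], expressed without a unit. *)
Lemma sqrt_one_minus a : cstar a = a -> rnorm a < 1 ->
  exists w, [/\ cstar w = w, 2 *: w = a + cmul w w
    & forall b, cmul a b = cmul b a -> cmul w b = cmul b w].
Proof.
move=> sa a1; have a0 := rnorm_ge0 a.
have [||w wl] := @rcvg_geometric (visser a) ((1 + rnorm a) / 2) _ _
  (fun n => @visser_dist a n a1); [lra|lra|].
exists w; split=> [||b ab].
- apply/eqP; rewrite -subr_eq0; apply/eqP; apply: (@rnorm_small _ _ 2) => e e0.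
  have [N /(_ N (leqnn N)) NN] := wl _ e0.
  have -> : cstar w - w = cstar (w - visser a N) - (w - visser a N).
    by rewrite cstarB visser_star// opprB addrA subrK.
  rewrite (le_trans (rnormD _ _))// rnormN rnorm_cstar; lra.
- apply/eqP; rewrite -subr_eq0; apply/eqP.
  apply: (@rnorm_small _ _ (2 + (1 + rnorm a) / 2 + rnorm w)) => e e0.
  have [N Nn] := wl _ e0.
  have NN := Nn N (leqnn N); have NS := Nn N.+1 (leqnSn N).
  set v := visser a N in NN *.
  have -> : 2 *: w - (a + cmul w w) = 2 *: (w - visser a N.+1) -
      (cmul w (w - v) + cmul (w - v) v).
    rewrite cmulBr cmulBl subrKA scalerBr /= scalerA mulrC half2C scale1r.
    by rewrite !opprD !opprK !addrA [RHS](ACl (1*2*4*3*5)) /= -/v subrK.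
  have -> : (2 : R[i]) = (2 : R)%:C by rewrite rmorph_nat.
  have h := rnormD ((2 : R)%:C *: (w - visser a N.+1)) (- (cmul w (w - v) + cmul (w - v) v)).
  rewrite rnormN rnormZ ger0_norm// in h.
  have h1 := rnormD (cmul w (w - v)) (cmul (w - v) v).
  have h2 := rnormM w (w - v); have h3 := rnormM (w - v) v.
  have h4 : rnorm v <= (1 + rnorm a) / 2 by exact: visser_bound.
  have q1 : rnorm w * rnorm (w - v) <= rnorm w * e.
    by rewrite ler_wpM2l ?rnorm_ge0 ?ltW.
  have q2 : rnorm (w - v) * rnorm v <= e * ((1 + rnorm a) / 2).
    by rewrite ler_pM ?rnorm_ge0// ltW.
  lra.
- apply/eqP; rewrite -subr_eq0; apply/eqP.
  apply: (@rnorm_small _ _ (2 * rnorm b)) => e e0.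
  have [N /(_ N (leqnn N)) NN] := wl _ e0.
  have -> : cmul w b - cmul b w = cmul (w - visser a N) b - cmul b (w - visser a N).
    by rewrite cmulBl cmulBr visser_comm// opprB addrA subrK.
  have h := rnormD (cmul (w - visser a N) b) (- cmul b (w - visser a N)).
  rewrite rnormN in h.
  have h1 := rnormM (w - visser a N) b; have h2 := rnormM b (w - visser a N).
  have q : rnorm (w - visser a N) * rnorm b <= e * rnorm b.
    by rewrite ler_wpM2r ?rnorm_ge0 ?ltW.
  lra.
Qed.

Lemma rnorm_isom x y : cmul (cstar x) x = cmul (cstar y) y -> rnorm x = rnorm y.
Proof.
move=> xy; apply/eqP; rewrite -(@eqrXn2 _ 2) ?rnorm_ge0//.
by rewrite -!rnorm_star xy.
Qed.

End SquareRoot.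

Section UnitaryDilation.
Variables (R : realType) (A : cstarAlgType R).
Implicit Types (a w x y : A) (u v : unitz A).

(** Put [z = 1 - w]: the hypotheses say that [z^2 = 1 - y^2] and that [z] commutes with [y]. As [e]
    is ['i] or [- 'i], the element [U = y + e z] is unitary; the computation shows that [x] and
    [U x] have the same [x^* x], hence the same norm. *)
Lemma isometry_sqrt y w (e : R[i]) : cstar y = y -> cstar w = w ->
  2 *: w = cmul y y + cmul w w -> cmul w y = cmul y w ->
  e^* = - e -> e * e = -1 ->
  forall x, rnorm (act (inA y + e *: (1 - inA w)) x) = rnorm x.
Proof.
move=> sy sw ww wy ec ee x; apply: rnorm_isom.
have -> : act (inA y + e *: (1 - inA w)) x = cmul y x + e *: (x - cmul w x).
  rewrite actDl actZl act_inA; congr (_ + _ *: _).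
  by rewrite -scaleN1r actDl actZl act1 act_inA scaleN1r.
rewrite cstarD cstarZ cstarB !cstarM sy sw ec.
set x' := cstar x.
rewrite !(cmulDl, cmulDr, cmulBl, cmulBr, cmulZl, cmulZr) !scalerBr !scalerA.
rewrite mulNr ee opprK !scale1r.
have E1 : cmul (cmul x' w) (cmul y x) = cmul (cmul x' y) (cmul w x).
  by rewrite !cmulA -(cmulA x' w) wy !cmulA.
have E2 : cmul (cmul x' y) x = cmul x' (cmul y x) by rewrite cmulA.
have E3 : cmul (cmul x' w) x = cmul x' (cmul w x) by rewrite cmulA.
rewrite E1 E2 E3.
have -> : cmul (cmul x' y) (cmul y x) =
    cmul x' (cmul w x) + cmul x' (cmul w x) - cmul (cmul x' w) (cmul w x).
  have := congr1 (fun z => cmul x' (cmul z x)) ww.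
  rewrite !(cmulDl, cmulDr, cmulZl, cmulZr) -[2]/(1 + 1) scalerDl scale1r.
  by rewrite !cmulA => ->; rewrite addrK.
rewrite !scaleNr opprK opprB !addrA.
rewrite [LHS](ACl (8*(1*9)*(2*11)*(10*3)*(4*6)*(7*5))) /=.
by rewrite !subrr !addr0.
Qed.

(** Take the unitary [u = y + 'i sqrt (1 - y^2)] with real part [y], and [v = u^2], [v' = u^-2]. The
    first identity is the double angle formula for the cosine, the second is the square of
    [2 y u = u^2 + 1]. Squares of [u] suffice because only [y^2] enters. *)
Lemma unitary_dilation y : cstar y = y -> rnorm y < 1 ->
  exists v v', [/\ forall x, rnorm (act v x) = rnorm x,
    forall x, rnorm (act v' x) = rnorm x,
    v + v' = inA (cmul y y) *+ 4 - 1 *+ 2,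
    (inA (cmul y y) * v) *+ 4 = (v + 1) ^+ 2
    & inA (cmul y y) * v = v * inA (cmul y y)].
Proof.
move=> sy y1.
have [||w [sw ww wc]] := @sqrt_one_minus R A (cmul y y).
- by rewrite cstarM sy.
- rewrite (le_lt_trans (rnormM _ _))//; have := rnorm_ge0 y; nra.
have wy : cmul w y = cmul y w by apply: wc; rewrite cmulA.
pose Y := inA y; have [Z ZE] : {Z | Z = 1 - inA w} by exists (1 - inA w).
have ZY : Z * Y = Y * Z.
  by rewrite ZE mulrBl mulrBr mul1r mulr1 -!inAM wy.
have ZZ : Z * Z = 1 - Y * Y.
  rewrite ZE mulrBl !mulrBr mul1r !mulr1 -!inAM.
  have /(congr1 (@inA _ A)) := ww; rewrite inAZ inAD scaler_nat mulr2n => e.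
  have -> : inA (cmul y y) = inA w + inA w - inA (cmul w w) by rewrite e addrK.
  by rewrite mul1r !opprB opprD !addrA [LHS](ACl (1*3*2*4)).
pose u (e : R[i]) := Y + e *: Z.
have uu e : e * e = -1 -> u e ^+ 2 = (Y * Y) *+ 2 - 1 + (e *: (Y * Z)) *+ 2.
  move=> ee; rewrite expr2 /u mulrDl !mulrDr -!scalerAl -!scalerAr scalerA ee.
  rewrite scaleN1r ZY ZZ opprB !mulr2n !addrA.
  by rewrite [LHS](ACl (1*4*5*2*3)).
have uY e : u e * Y = Y * u e.
  by rewrite mulrDl mulrDr -scalerAl -scalerAr ZY.
have I e : e^* = - e -> e * e = -1 -> forall x, rnorm (act (u e) x) = rnorm x.
  by rewrite /u ZE; exact: isometry_sqrt.
have ii : 'i * 'i = -1 :> R[i] by rewrite -expr2 sqrCi.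
have ic : ('i : R[i])^* = - 'i by rewrite conjCi.
have nn : - 'i * - 'i = -1 :> R[i] by rewrite mulrNN.
have nc : (- 'i : R[i])^* = - - 'i by rewrite rmorphN /= ic.
exists (u 'i ^+ 2), (u (- 'i) ^+ 2); split=> [x|x|||].
- by rewrite actM !(I _ ic ii).
- by rewrite actM !(I _ nc nn).
- rewrite !uu// scaleNr inAM -/Y !mulNrn (mulrnDr _ 2 2) (mulrnDr 1 1 1).
  move: (_ *+ 2) (_ *+ 2) => p g; rewrite !addrA opprD.
  by rewrite [LHS](ACl (1*4*2*5*(3*6))) /= subrr addr0 !addrA.
- have -> : u 'i ^+ 2 + 1 = (Y * u 'i) *+ 2.
    by rewrite uu// addrAC subrK mulrDr scalerAr mulrnDl.
  rewrite inAM -/Y [RHS]expr2 mulrnAl mulrnAr -mulrnA; congr (_ *+ 4).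
  by rewrite expr2 !mulrA; congr (_ * _); rewrite -!mulrA uY.
- rewrite inAM -/Y expr2; have c : GRing.comm Y (u 'i) by rewrite /GRing.comm uY.
  by apply: commrM; apply/commr_sym; apply: commrM; apply/commr_sym.
Qed.

End UnitaryDilation.

(** * Polynomials in a self-adjoint element *)

(* Averaging over [z] and [- z] passes the bound to the even and odd parts. *)
Lemma coef_le_sup_circle (C : numClosedFieldType) (B : C) (p : {poly C}) :
  (forall z, `|z| = 1 -> `|p.[z]| <= B) -> forall j, `|p`_j| <= B.
Proof.
have [n] := ubnP (size p); elim: n p => // n IH p pn pB.
have [p1 j|p1] := leqP (size p) 1.
  rewrite (size1_polyC p1) coefC; have := pB 1 (normr1 _).
  rewrite (size1_polyC p1) hornerC coefC eqxx; case: (j == 0%N) => //.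
  by rewrite normr0; exact: le_trans.
have pE z : p.[z] = (even_poly p).[z ^+ 2] + (odd_poly p).[z ^+ 2] * z.
  by rewrite -{1}(poly_even_odd p) hornerD hornerM hornerX !horner_comp hornerXn.
(* Every point of the circle is [w ^+ 2] with [w] on the circle; the values at [w] and [- w] then
   isolate the even and odd parts at [w ^+ 2]. *)
have half (z : C) : `|z| = 1 -> exists2 w : C, `|w| = 1 & z = w ^+ 2.
  move=> z1; exists (sqrtC z); last by rewrite sqrtCK.
  by apply/eqP; rewrite -(@eqrXn2 _ 2)// -normrX sqrtCK z1 expr1n.
have two (x y : C) : `|x| <= B -> `|y| <= B -> `|(x + y) / 2| <= B.
  move=> xB yB; rewrite normrM normfV normr_nat ler_pdivrMr//.
  by rewrite (le_trans (ler_normD _ _))// mulr_natr mulr2n lerD.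
have evenB z : `|z| = 1 -> `|(even_poly p).[z]| <= B.
  move=> /half[w w1 ->]; have wN : `|- w| = 1 by rewrite normrN.
  have := two _ _ (pB _ w1) (pB _ wN); rewrite !pE sqrrN mulrN.
  rewrite [X in X / 2](_ : _ = (even_poly p).[w ^+ 2] * 2); last by ring.
  by rewrite mulfK ?pnatr_eq0.
have oddB z : `|z| = 1 -> `|(odd_poly p).[z]| <= B.
  move=> /half[w w1 ->]; have wN : `|- w| = 1 by rewrite normrN.
  have pNB : `|- p.[- w]| <= B by rewrite normrN pB.
  have := two _ _ (pB _ w1) pNB; rewrite !pE sqrrN mulrN opprB.
  rewrite [X in X / 2](_ : _ = (odd_poly p).[w ^+ 2] * w * 2); last by ring.
  by rewrite mulfK ?pnatr_eq0// normrM w1 mulr1.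
move=> j; rewrite -[j]odd_double_half; case: (odd j).
  rewrite add1n -coef_odd_poly; apply: IH => //.
  by rewrite (leq_ltn_trans (size_odd_poly _))//; move: (size p) p1 pn; lia.
rewrite add0n -coef_even_poly; apply: IH => //.
rewrite (leq_ltn_trans (size_even_poly _))//.
by move: (size p) p1 pn => m; rewrite uphalf_half; lia.
Qed.

Lemma horner_algE (R : comNzRingType) (A : algType R) (a : A) n (f : {poly R}) :
  (size f <= n)%N -> horner_alg a f = \sum_(i < n) f`_i *: a ^+ i.
Proof.
move=> fn; have {1}-> : f = \poly_(i < n) f`_i.
  apply/polyP => i; rewrite coef_poly; case: ltnP => // ni.
  by rewrite nth_default// (leq_trans fn).
rewrite poly_def raddf_sum; apply: eq_bigr => i _.
by rewrite /= linearZ rmorphXn /= horner_algX mulr_algl.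
Qed.

Section SpectralBound.
Variables (R : realType) (A : cstarAlgType R).
Implicit Types (k x : A) (f : {poly R[i]}).

Local Notation cabs z := (rnorm (z : R[i]^o)).

Lemma rnorm_sum (V : normedModType R[i]) (I : Type) (s : seq I) (P : pred I)
    (F : I -> V) :
  rnorm (\sum_(i <- s | P i) F i) <= \sum_(i <- s | P i) rnorm (F i).
Proof.
elim/big_rec2: _ => [|i y x _ IH]; first by rewrite rnorm0.
by rewrite (le_trans (rnormD _ _))// lerD2l.
Qed.

Lemma scaled_dilation k (s : R) : cstar k = k -> rnorm k < s ->
  exists v v', [/\ forall x, rnorm (act v x) = rnorm x,
    forall x, rnorm (act v' x) = rnorm x,
    (s ^+ 2)%:C *: (v + v') = inA (cmul k k) *+ 4 - ((s ^+ 2)%:C *: 1) *+ 2,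
    inA (cmul k k) * v = (s ^+ 2 / 4)%:C *: (v + 1) ^+ 2
    & inA (cmul k k) * v = v * inA (cmul k k)].
Proof.
move=> sk ks; have s0 : 0 < s by exact: le_lt_trans (rnorm_ge0 _) ks.
have sC : (s ^+ 2)%:C != 0 by rewrite fmorph_eq0 expf_eq0 gt_eqF.
have [||v [v' [v1 v2 vv hv cv]]] := @unitary_dilation R A ((s^-1)%:C *: k).
- by rewrite cstarZ conj_realC sk.
- by rewrite rnormZ ger0_norm ?invr_ge0 ?ltW// mulrC ltr_pdivrMr// mul1r.
have hE : inA (cmul k k) =
    (s ^+ 2)%:C *: inA (cmul ((s^-1)%:C *: k) ((s^-1)%:C *: k)).
  rewrite -inAZ cmulZl cmulZr !scalerA -!rmorphM /=.
  by rewrite mulrA expr2 mulfK ?gt_eqF// mulfV ?gt_eqF// scale1r.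
exists v, v'; split=> //.
- by rewrite vv scalerBr hE !scalerMnr.
- rewrite rmorphM /= fmorphV rmorph_nat -scalerA -hv hE -scalerAl.
  by rewrite -[(_ * v) *+ 4]scaler_nat [X in _ = _ *: X]scalerA mulVf ?pnatr_eq0// scale1r.
- by rewrite hE -scalerAl -scalerAr cv.
Qed.

(** Write [h = k^2]. Multiplying by the isometry [v ^+ N] turns [f(h)] into a polynomial [G] of
    degree at most [2 N] in [v]. On the unit circle [|G|] takes values of [|f|] on [[0, s^2]], so
    each of its [2 N + 1] coefficients is at most [B], while powers of [v] preserve norms. *)
Lemma act_polynomial_bound_lt k (s B : R) N f x : cstar k = k -> rnorm k < s ->
  (size f <= N.+1)%N ->
  (forall t : R, 0 <= t <= s ^+ 2 -> cabs f.[t%:C] <= B) ->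
  rnorm (act (horner_alg (inA (cmul k k)) f) x) <= N.*2.+1%:R * B * rnorm x.
Proof.
have half_interval (a q : R) : -1 <= a <= 1 -> 0 <= q ->
    0 <= q * ((1 + a) / 2) <= q.
  by move=> /andP[a1 a2] q0; apply/andP; split; nra.
move=> sk ks fN fB.
have [v [_ [v1 _ _ hv cv]]] := scaled_dilation sk ks.
have v1n n y : rnorm (act (v ^+ n) y) = rnorm y.
  by elim: n y => [|n IH] y; rewrite ?expr0 ?act1// exprS actM v1.
set h := inA (cmul k k) in hv cv *; set c := (s ^+ 2 / 4)%:C in hv.
(* Comes from [h^i v^i = c^i (v + 1)^(2 i)], with [v^(N - i)] left over. *)
pose G : {poly R[i]} := \sum_(i < N.+1)
  (f`_i * c ^+ i) *: ('X^(N - i) * ('X + 1) ^+ i.*2).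
have sG : (size G <= N.*2.+1)%N.
  apply: (leq_trans (size_sum _ _ _)); apply/bigmax_leqP => i _.
  rewrite (leq_trans (size_scale_leq _ _))// (leq_trans (size_polyMleq _ _))//.
  rewrite size_polyXn -[1]opprK -polyCN size_exp_XsubC.
  by have := ltn_ord i; rewrite -!addnn; lia.
have vG : v ^+ N * horner_alg h f = horner_alg v G.
  rewrite (horner_algE _ fN) raddf_sum mulr_sumr; apply: eq_bigr => i _ /=.
  rewrite linearZ /= rmorphM !rmorphXn rmorphD rmorph1 /= horner_algX.
  have -> : v ^+ N = v ^+ (N - i) * v ^+ i.
    by rewrite -exprD subnK// -ltnS.
  rewrite mulr_algl -scalerAr -mulrA -scalerA; congr (_ *: _).
  rewrite scalerAr; congr (_ * _).
  have /exprMn_comm <- : GRing.comm v h by rewrite /GRing.comm cv.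
  by rewrite -cv hv exprZn -exprM mul2n.
have GB z : `|z| = 1 -> `|G.[z]| <= B%:C.
  move=> z1; have z0 : z != 0 by rewrite -normr_eq0 z1 oner_eq0.
  (* For [|z| = 1] one has [(z + 1)^2 = 2 (1 + Re z) z], which singles out [t] as the point where
     [f] is evaluated. *)
  pose t := s ^+ 2 * ((1 + complex.Re z) / 2).
  have zz : complex.Re z ^+ 2 + complex.Im z ^+ 2 = 1.
    by apply: (@complexI R); rewrite add_Re2_Im2 z1 expr1n.
  have tE : t%:C * z = c * (z + 1) ^+ 2.
    move: zz; rewrite /t /c; case: (z) => a b /= ab.
    apply/eqP; rewrite eq_complex /=; apply/andP; split; apply/eqP; last by field.
    have -> : (b + 0) * (b + 0) = 1 - a ^+ 2 by rewrite -ab; ring.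
    by field.
  have -> : G.[z] = z ^+ N * f.[t%:C].
    rewrite /G horner_sum (horner_coef_wide _ fN) mulr_sumr; apply: eq_bigr => i _.
    rewrite !hornerE /=; have -> : z ^+ N = z ^+ (N - i) * z ^+ i.
      by rewrite -exprD subnK// -ltnS.
    have := congr1 (fun w => w ^+ i) tE; rewrite /= exprMn [in RHS]exprMn -exprM mul2n => e.
    transitivity (f`_i * z ^+ (N - i) * (c ^+ i * (z + 1) ^+ i.*2)); first by ring.
    by rewrite -e; ring.
  rewrite normrM normrX z1 expr1n mul1r normcE_rnorm lecR fB//.
  apply: half_interval; last exact: sqr_ge0.
  by rewrite -ler_norml -lecR (le_trans (normc_ge_Re z))// z1.
rewrite -(v1n N) -actM vG (horner_algE _ sG) act_suml.
rewrite (le_trans (rnorm_sum _ _ _))// -mulrA.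
rewrite (@le_trans _ _ (\sum_(i < N.*2.+1) B * rnorm x))//; last first.
  by rewrite sumr_const card_ord mulr_natl.
apply: ler_sum => i _; rewrite actZl rnormZC v1n ler_wpM2r ?rnorm_ge0//.
by rewrite -lecR -normcE_rnorm; exact: coef_le_sup_circle.
Qed.

End SpectralBound.

Section SpectralBoundClosed.
Variables (R : realType) (A : cstarAlgType R).
Implicit Types (k x : A) (f : {poly R[i]}).

Local Notation cabs z := (rnorm (z : R[i]^o)).

Lemma cabsM (z w : R[i]) : cabs (z * w) = cabs z * cabs w.
Proof. exact: (@rnormZC R R[i]^o z w). Qed.

Lemma cabs_real (x : R) : cabs x%:C = `|x|.
Proof.
apply: (@complexI R); rewrite -normcE_rnorm normc_def /= expr0n /= addr0.
by rewrite sqrtr_sqr.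
Qed.

Lemma poly_lipschitz f (b : R) : exists2 L : R, 0 <= L &
  forall x y : R, 0 <= x <= b -> 0 <= y <= b ->
  cabs (f.[x%:C] - f.[y%:C]) <= L * `|x - y|.
Proof.
(* The induction along Horner's scheme needs a bound [M] for [f] itself together with the Lipschitz
   constant [L]. *)
suff [L [M [L0 _ fL _]]] : exists L M : R, [/\ 0 <= L, 0 <= M,
    forall x y : R, 0 <= x <= b -> 0 <= y <= b ->
      cabs (f.[x%:C] - f.[y%:C]) <= L * `|x - y|
    & forall x : R, 0 <= x <= b -> cabs f.[x%:C] <= M] by exists L.
elim/poly_ind: f => [|f c [L [M [L0 M0 fL fM]]]].
  exists 0, 0; split=> // [x y _ _|x _]; last by rewrite horner0 rnorm0.
  by rewrite !horner0 subrr rnorm0 mul0r.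
exists (L * `|b| + M), (M * `|b| + cabs c); split.
- by rewrite addr_ge0// mulr_ge0.
- by rewrite addr_ge0 ?mulr_ge0 ?rnorm_ge0.
- move=> x y xb yb; rewrite !hornerE /=.
  have -> : f.[x%:C] * x%:C + c - (f.[y%:C] * y%:C + c) =
      (f.[x%:C] - f.[y%:C]) * x%:C + f.[y%:C] * (x - y)%:C.
    by rewrite rmorphB /=; ring.
  rewrite (le_trans (@rnormD _ R[i]^o _ _))// [leRHS]mulrDl lerD//.
    rewrite cabsM cabs_real mulrAC ler_pM ?rnorm_ge0 ?fL//.
    by case/andP: xb => x0 xb; rewrite !ger0_norm// (le_trans x0).
  by rewrite cabsM cabs_real ler_wpM2r ?fM.
- move=> x xb; rewrite !hornerE /=.
  rewrite (le_trans (@rnormD _ R[i]^o _ _))// lerD2r cabsM cabs_real.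
  rewrite ler_pM ?rnorm_ge0 ?fM//.
  by case/andP: xb => x0 xb; rewrite !ger0_norm// (le_trans x0).
Qed.

Lemma sqrt_gt (s e : R) : 0 <= s -> 0 < e ->
  s < Num.sqrt (s ^+ 2 + e) /\ Num.sqrt (s ^+ 2 + e) ^+ 2 = s ^+ 2 + e.
Proof.
move=> s0 e0; have se : 0 < s ^+ 2 + e by rewrite ltr_wpDl ?sqr_ge0.
rewrite sqr_sqrtr ?ltW//; split=> //.
by rewrite -{1}(ger0_norm s0) -sqrtr_sqr ltr_sqrt// ltrDl.
Qed.

(** The case of a strict norm bound is applied with the slightly larger [sqrt (s^2 + d)] in place of
    [s]; the Lipschitz bound controls [f] on the added interval, and [d] can be made as small as
    desired. *)
Lemma act_polynomial_bound k (s B : R) N f x : cstar k = k -> rnorm k <= s ->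
  (size f <= N.+1)%N ->
  (forall t : R, 0 <= t <= s ^+ 2 -> cabs f.[t%:C] <= B) ->
  rnorm (act (horner_alg (inA (cmul k k)) f) x) <= N.*2.+1%:R * B * rnorm x.
Proof.
move=> sk ks fN fB; have s0 : 0 <= s := le_trans (rnorm_ge0 k) ks.
have [L L0 fL] := poly_lipschitz f (s ^+ 2 + 1).
pose C := N.*2.+1%:R * L * rnorm x + 1.
have C0 : 0 < C by rewrite ltr_wpDl ?mulr_ge0 ?rnorm_ge0.
apply/ler_addgt0Pr => e e0.
pose d := Num.min 1 (e / C).
have d0 : 0 < d by rewrite lt_min ltr01 divr_gt0.
have d1 : d <= 1 by rewrite ge_min lexx.
have dC : d * C <= e by rewrite -ler_pdivlMr// ge_min lexx orbT.
have [sd sdE] := sqrt_gt s0 d0.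
have := @act_polynomial_bound_lt R A k _ (B + L * d) N f x sk (le_lt_trans ks sd) fN.
rewrite sdE => h; apply: (le_trans (h _)); last first.
  move: dC; rewrite /C; set n := N.*2.+1%:R; set y := rnorm x => dC.
  have -> : n * (B + L * d) * y = n * B * y + (n * L * y) * d by ring.
  by rewrite lerD2l (le_trans _ dC)// [leLHS]mulrC ler_pM2l// lerDl.
move=> t /andP[t0 td].
have [ts|st] := leP t (s ^+ 2).
  by rewrite (le_trans (fB _ _)) ?t0// lerDl mulr_ge0// ltW.
have s20 : 0 <= s ^+ 2 by exact: sqr_ge0.
rewrite -[f.[_]](subrK f.[(s ^+ 2)%:C]) (le_trans (@rnormD _ R[i]^o _ _))//.
rewrite addrC lerD ?fB ?s20 ?lexx// (le_trans (fL _ _ _ _))//.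
- by rewrite t0/= (le_trans td)// lerD2l.
- by rewrite s20 lerDl ler01.
by rewrite ler_wpM2l// ger0_norm ?subr_ge0 ?(ltW st)// lerBlDl.
Qed.

(** Expresses [0 <= k^2 <= s^2] without an order on [A]: up to enlarging [s], [2 k^2 - s^2] is [s^2]
    times the mean of two isometries. *)
Lemma square_centered_bound k (s : R) x : cstar k = k -> rnorm k <= s ->
  rnorm ((2 : R)%:C *: cmul (cmul k k) x - (s ^+ 2)%:C *: x) <= s ^+ 2 * rnorm x.
Proof.
move=> sk ks; have s0 : 0 <= s := le_trans (rnorm_ge0 k) ks.
apply/ler_addgt0Pr => e e0.
have x1 : 0 < 2 * rnorm x + 1 by rewrite ltr_wpDl// mulr_ge0// rnorm_ge0.
pose d := e / (2 * rnorm x + 1); have d0 : 0 < d by rewrite divr_gt0.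
have dx : d * (2 * rnorm x + 1) = e by rewrite /d divfK// gt_eqF.
have [sd sdE] := sqrt_gt s0 d0.
have [v [v' [v1 v2]]] := scaled_dilation sk (le_lt_trans ks sd).
rewrite sdE => vv _ _.
have E : (s ^+ 2 + d)%:C *: (act v x + act v' x) =
    (2 : R)%:C *: ((2 : R)%:C *: cmul (cmul k k) x - (s ^+ 2 + d)%:C *: x).
  rewrite -actDl -actZl vv -[_ *+ 4]scaler_nat -[_ *+ 2]scaler_nat.
  rewrite -scaleN1r !(actDl, actZl) act1 act_inA scaleN1r.
  rewrite (rmorph_nat (@real_complex R)) scalerBr.
  by congr (_ - _); rewrite scalerA -natrM.
have sd0 : 0 < s ^+ 2 + d by rewrite ltr_wpDl ?sqr_ge0.
have h : rnorm ((2 : R)%:C *: cmul (cmul k k) x - (s ^+ 2 + d)%:C *: x) <=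
    (s ^+ 2 + d) * rnorm x.
  rewrite -(@ler_pM2l _ 2)//.
  have := congr1 (@rnorm R A) E; rewrite !rnormZ (ger0_norm (ltW sd0)) ger0_norm// => <-.
  rewrite mulrCA ler_pM2l// (le_trans (rnormD _ _))// v1 v2; lra.
have -> : (2 : R)%:C *: cmul (cmul k k) x - (s ^+ 2)%:C *: x =
    ((2 : R)%:C *: cmul (cmul k k) x - (s ^+ 2 + d)%:C *: x) + d%:C *: x.
  by rewrite (rmorphD _ (s ^+ 2) d) /= scalerDl opprD addrA subrK.
rewrite (le_trans (rnormD _ _))// rnormZ ger0_norm ?ltW//.
move: h dx; have := rnorm_ge0 x; move: (rnorm _) (rnorm _) => p q; lra.
Qed.

End SpectralBoundClosed.

(** * Powers and the algebra generated by an idempotent *)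

(** If [x > M], exponential growth beats the linear factor. Only powers of two are tested, because
    the iterated C*-identity gives the norms of exactly these powers. *)
Lemma power_root_le (R : realType) (x M C : R) (d : nat) : 0 <= x -> 0 <= M ->
  (forall j n, n = (2 ^ j)%N -> (d <= n)%N ->
    x ^+ n <= C * n%:R * M ^+ (n - d)) -> x <= M.
Proof.
move=> x0 M0 h; apply/ler_addgt0Pr => e e0; rewrite leNgt; apply/negP => xM.
pose M' := M + e; have M'0 : 0 < M' by rewrite ltr_wpDl.
pose K := `|C| / M' ^+ d.
have K0 : 0 <= K by rewrite divr_ge0// exprn_ge0// ltW.
pose a := x / M' - 1.
have a0 : 0 < a by rewrite subr_gt0 ltr_pdivlMr// mul1r.
have hK j n : n = (2 ^ j)%N -> (d <= n)%N -> (1 + a) ^+ n <= K * n%:R.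
  move=> nj dn; rewrite /a addrCA subrr addr0 expr_div_n ler_pdivrMr ?exprn_gt0//.
  apply: (le_trans (h _ _ nj dn)).
  have -> : K * n%:R * M' ^+ n = `|C| * n%:R * M' ^+ (n - d).
    have -> : M' ^+ n = M' ^+ (n - d) * M' ^+ d by rewrite -exprD subnK.
    by rewrite /K; field; rewrite expf_neq0// gt_eqF.
  rewrite (@le_trans _ _ (`|C| * n%:R * M ^+ (n - d)))//.
    by rewrite !ler_wpM2r ?exprn_ge0 ?ler_norm.
  rewrite ler_wpM2l ?mulr_ge0// lerXn2r ?nnegrE ?addr_ge0 ?(ltW e0)//.
  by rewrite lerDl ltW.
have bern m : m%:R * a <= (1 + a) ^+ m.
  suff : 1 + m%:R * a <= (1 + a) ^+ m by lra.
  elim: m => [|m IH]; first by rewrite mul0r addr0 expr0.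
  rewrite exprS -natr1; have : 0 <= m%:R :> R by [].
  move: IH; move: (m%:R) (_ ^+ _) => p q; nra.
(* At exponent [2 m] the Bernoulli bound appears squared: [(m a)^2 <= (1 + a)^(2 m) <= 2 K m], which
   fails for large [m]. *)
have lin m j : m = (2 ^ j)%N -> (d <= m)%N -> m%:R * a ^+ 2 <= 2 * K.
  move=> mj dm.
  have m0 : 0 < m%:R :> R by rewrite ltr0n mj expn_gt0.
  have := hK j.+1 m.*2; rewrite expnS -mj mul2n => /(_ erefl).
  rewrite -{1}addnn => /(_ (leq_trans dm (leq_addr _ _))).
  rewrite -muln2 exprM natrM => hm.
  rewrite -(ler_pM2l m0); have := bern m.
  have ma : 0 <= m%:R * a by rewrite mulr_ge0 ?ltW.
  move: hm m0 ma; move: (m%:R) (_ ^+ m) => p q; nra.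
pose j := maxn d (Num.bound (2 * K / a ^+ 2)).
have jm : (j <= 2 ^ j)%N by rewrite ltnW// ltn_expl.
have := lin _ j erefl (leq_trans (leq_maxl _ _) jm).
apply/negP; rewrite -ltNge -ltr_pdivrMr ?exprn_gt0//.
rewrite (lt_le_trans (archi_boundP _))//.
  by rewrite divr_ge0 ?sqr_ge0// mulr_ge0.
by rewrite ler_nat (leq_trans (leq_maxr _ _) jm).
Qed.

Section Powers.
Variables (R : realType) (A : cstarAlgType R).
Implicit Types (T x y : A).

(** The power [T^(n + 1)]: the exponent is shifted because [A] may have no unit. *)
Definition apow T n : A := act (inA T ^+ n) T.

Lemma inA_apow T n : inA (apow T n) = inA T ^+ n.+1.
Proof. by rewrite inA_act exprSr. Qed.

Lemma apowD T m n : cmul (apow T m) (apow T n) = apow T (m + n).+1.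
Proof. by apply: inA_inj; rewrite inAM !inA_apow -exprD addnS. Qed.

Lemma apowS T n : apow T n.+1 = cmul (apow T n) T.
Proof. by apply: inA_inj; rewrite inAM !inA_apow [LHS]exprSr. Qed.

Lemma apow0 T : apow T 0 = T.
Proof. by rewrite /apow expr0 act1. Qed.

Lemma apow_star T n : cstar T = T -> cstar (apow T n) = apow T n.
Proof.
move=> sT; elim: n => [|n IH]; first by rewrite apow0.
rewrite {1}apowS cstarM sT IH; apply: inA_inj.
by rewrite inAM !inA_apow -exprS.
Qed.

Lemma rnorm_apow T j : cstar T = T ->
  rnorm (apow T (2 ^ j).-1) = rnorm T ^+ (2 ^ j).
Proof.
move=> sT; elim: j => [|j IH]; first by rewrite apow0 expr1.
rewrite expnS mul2n -addnn exprD -IH -expr2 -rnorm_star apow_star//.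
rewrite apowD; congr (rnorm (apow T _)).
by have := expn_gt0 2 j; lia.
Qed.

End Powers.

(** * Words in an idempotent and its adjoint *)

Section Idempotent.
Variables (R : realType) (A : cstarAlgType R) (q : A).

Definition letter (b : bool) : A := if b then cstar q else q.

(* The normal form of an alternating word in [q] and [q^*] with first letter
   [a] and last letter [b], up to powers of the central element below. *)
Definition word (a b : bool) : A :=
  if a == b then letter a else cmul (letter a) (letter b).

(** Twice the imaginary part of [q]. *)
Definition idem_im : A := (- 'i : R[i]) *: (q - cstar q).

Definition idem_center : A := cmul idem_im idem_im.

Lemma idem_im_star : cstar idem_im = idem_im.
Proof.
rewrite /idem_im cstarZ cstarB cstarK rmorphN /= conjCi opprK.
by rewrite -opprB scalerN scaleNr.
Qed.

Hypothesis qq : cmul q q = q.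

Local Notation H := (inA idem_center).
Local Notation L b := (inA (letter b)).
Local Notation W a b := (inA (word a b)).

Lemma letter_idem b : L b * L b = L b.
Proof. by case: b; rewrite -inAM /= -?cstarM qq. Qed.

Lemma idem_centerE b :
  H = L b * L (~~ b) + L (~~ b) * L b - L b - L (~~ b).
Proof.
have -> : H = L false * L true + L true * L false - L false - L true.
  rewrite -!inAM -inAD /= /idem_center /idem_im cmulZl cmulZr scalerA mulrNN.
  rewrite -expr2 sqrCi scaleN1r cmulBl !cmulBr qq -cstarM qq.
  rewrite -!inAB; congr inA; rewrite opprB opprB addrA.
  by rewrite [LHS](ACl (3*1*4*2)).
by case: b; rewrite //= addrAC [L true * _ + _]addrC addrAC.
Qed.

Lemma center_letter b : H * L b = L b * L (~~ b) * L b - L b.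
Proof.
rewrite (idem_centerE b) !mulrBl mulrDl -(mulrA (L (~~ b))) letter_idem.
by rewrite [LHS](ACl (1*3*(2*4))) /= subrr addr0.
Qed.

Lemma comm_center_letter b : H * L b = L b * H.
Proof.
rewrite center_letter (idem_centerE b) !mulrBr mulrDr !mulrA letter_idem.
by rewrite [RHS](ACl (2*3*(1*4))) /= subrr addr0.
Qed.

Lemma letter_alternating b : L b * L (~~ b) * L b = (1 + H) * L b.
Proof. by rewrite mulrDl mul1r center_letter addrC subrK. Qed.

Lemma comm_center_word a b : H * W a b = W a b * H.
Proof.
rewrite /word; case: eqP => _; first exact: comm_center_letter.
by rewrite inAM mulrA comm_center_letter -!mulrA comm_center_letter.
Qed.

(** The product is a string of letters: equal neighbours merge by idempotency, and each surplus pair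
    of letter changes along [a, b, c, d] is removed by [letter_alternating] at the cost of a factor
    [1 + H]. *)
Lemma word_mul a b c d : W a b * W c d =
  (1 + H) ^+ ((a != b) + (b != c) + (c != d))./2 * W a d.
Proof.
have [I0 I1] := (letter_idem false, letter_idem true).
have [A0 A1] := (letter_alternating false, letter_alternating true).
rewrite /= in I0 I1 A0 A1.
have J0 x : x * inA q * inA q = x * inA q by rewrite -mulrA I0.
have J1 x : x * inA (cstar q) * inA (cstar q) = x * inA (cstar q).
  by rewrite -mulrA I1.
set h := inA idem_center in A0 A1 *.
by case: a; case: b; case: c; case: d; rewrite /word /= ?inAM ?mulrA
  ?expr0 ?expr1 ?mul1r ?(J0, J1, I0, I1)// ?mulrA ?(J0, J1)// ?(A0, A1).
Qed.

Lemma rnorm_letter b : rnorm (letter b) = rnorm q.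
Proof. by case: b => //=; rewrite rnorm_cstar. Qed.

Lemma rnorm_word a b r : 1 <= r -> rnorm q <= r -> rnorm (word a b) <= r ^+ 2.
Proof.
move=> r1 qr; rewrite /word; case: eqP => _.
  by rewrite rnorm_letter (le_trans qr)// expr2 ler_peMr// (le_trans ler01).
rewrite (le_trans (rnormM _ _))// expr2.
by rewrite ler_pM ?rnorm_ge0// rnorm_letter.
Qed.

(** Two estimates are combined, with [h] the central element. As [y] is fixed by the letter [b],
    [y + h y] is [y] multiplied by both letters, of norm at most [r^2 |y|]; and
    [|2 h y - rho y| <= rho |y|] by [square_centered_bound]. The bound follows from [(2 + rho) h y =
    (2 h y - rho y) + rho (y + h y)]. *)
Lemma act_center_letter (r rho : R) b y : 0 <= rho ->
  rnorm q <= r -> rnorm idem_im ^+ 2 <= rho ->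
  cmul (letter b) y = y ->
  (1 + rho / 2) * rnorm (cmul idem_center y) <=
  (rho / 2 + rho / 2 * r ^+ 2) * rnorm y.
Proof.
move=> rho0 qr kr by_.
have [s0 sE] : 0 <= Num.sqrt rho /\ Num.sqrt rho ^+ 2 = rho.
  by rewrite sqrtr_ge0 sqr_sqrtr.
have ks : rnorm idem_im <= Num.sqrt rho.
  by rewrite -(@ler_pXn2r _ 2) ?nnegrE ?rnorm_ge0// sE.
have := square_centered_bound y idem_im_star ks; rewrite sE -/idem_center => h1.
have h2 : rnorm (y + cmul idem_center y) <= r ^+ 2 * rnorm y.
  have -> : y + cmul idem_center y = cmul (letter b) (cmul (letter (~~ b)) y).
    have by' : L b * inA y = inA y by rewrite -inAM by_.
    apply: inA_inj; rewrite inAD (inAM idem_center) !(inAM (letter _)).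
    by rewrite -{3}by' !mulrA letter_alternating -mulrA by' mulrDl mul1r.
  rewrite (le_trans (rnormM _ _))// expr2 -mulrA.
  have r0 : 0 <= r := le_trans (rnorm_ge0 _) qr.
  rewrite ler_pM ?rnorm_ge0 ?rnorm_letter//.
  by rewrite (le_trans (rnormM _ _))// ler_wpM2r ?rnorm_ge0 ?rnorm_letter.
have E : ((1 + rho / 2) * 2)%:C *: cmul idem_center y =
    ((2 : R)%:C *: cmul idem_center y - rho%:C *: y) +
    rho%:C *: (y + cmul idem_center y).
  rewrite scalerDr addrA subrK -scalerDl -rmorphD /=; congr (_%:C *: _).
  by field.
have p0 : 0 <= 1 + rho / 2 by lra.
have := congr1 (@rnorm R A) E; rewrite rnormZ ger0_norm ?mulr_ge0//.
have := rnormD ((2 : R)%:C *: cmul idem_center y - rho%:C *: y)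
  (rho%:C *: (y + cmul idem_center y)).
rewrite [X in _ <= _ + X]rnormZ (ger0_norm rho0).
have : rho * rnorm (y + cmul idem_center y) <= rho * (r ^+ 2 * rnorm y).
  by rewrite ler_wpM2l.
move: h1; move: (rnorm _) (rnorm _) (rnorm _) (rnorm _) (r ^+ 2) => *; nra.
Qed.

End Idempotent.

(** * The norm of the imaginary part of an idempotent *)

Section IdempotentNorm.
Variables (R : realType) (A : cstarAlgType R) (q : A).
Hypothesis qq : cmul q q = q.

Local Notation h := (idem_center q).
Local Notation H := (inA h).

Lemma idem_center_sum :
  h = cmul q (cstar q) + cmul (cstar q) q - q - cstar q.
Proof. by apply: inA_inj; rewrite (idem_centerE qq false) !inAB inAD !inAM. Qed.

Lemma idem_center_star : cstar h = h.
Proof. by rewrite cstarM !idem_im_star. Qed.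

Lemma rnorm_idem_center : rnorm h = rnorm (idem_im q) ^+ 2.
Proof. by rewrite -rnorm_star idem_im_star. Qed.

(** Here [rho = |h|]. By [act_center_letter], [h^n] maps the letters to elements of norm at most
    [theta^n r]; since [h] is a combination of words, [|h^(n + 1)|] is at most a constant times
    [theta^n]. Taking roots gives [rho <= theta], which amounts to [rho <= r^2 - 1] unless
    [rho = 0]. *)
Lemma rnorm_idem_im (r : R) : 1 <= r -> rnorm q <= r ->
  rnorm (idem_im q) ^+ 2 <= r ^+ 2 - 1.
Proof.
move=> r1 qr; set rho := rnorm _ ^+ 2.
have rho0 : 0 <= rho by exact: sqr_ge0.
have r0 : 0 <= r by exact: le_trans ler01 r1.
have p0 : 0 < 1 + rho / 2 by lra.
pose theta := (rho / 2 + rho / 2 * r ^+ 2) / (1 + rho / 2).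
have t0 : 0 <= theta.
  have rho2 : 0 <= rho / 2 by lra.
  by apply: divr_ge0 (ltW p0); rewrite addr_ge0// mulr_ge0// exprn_ge0.
have hb b n : rnorm (act (H ^+ n) (letter q b)) <= theta ^+ n * r.
  elim: n => [|n IH]; first by rewrite !expr0 act1 mul1r rnorm_letter.
  rewrite exprS actM act_inA; set y := act _ _ in IH *.
  have ly : cmul (letter q b) y = y.
    apply: inA_inj; rewrite inAM inA_act mulrA.
    have /commrX -/(_ n) -> := commr_sym (comm_center_letter qq b).
    by rewrite -mulrA letter_idem.
  have := act_center_letter qq rho0 qr (lexx _) ly.
  rewrite mulrC -ler_pdivlMr// => /le_trans; apply.
  by rewrite mulrAC -/theta exprS -mulrA ler_wpM2l.
(* The last factor of [h^(n + 1)] is expanded as [q q^* + q^* q - q - q^*]. *)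
have hq n : rnorm (apow h n) <= (2 * r * r + 2 * r) * theta ^+ n.
  have -> : apow h n = cmul (act (H ^+ n) (letter q false)) (cstar q)
      + cmul (act (H ^+ n) (letter q true)) q
      - act (H ^+ n) (letter q false) - act (H ^+ n) (letter q true).
    rewrite -!act_cmul; apply: inA_inj; rewrite /apow inA_act !inAB inAD !inA_act.
    by rewrite {2}idem_center_sum !inAB inAD !mulrBr mulrDr.
  have := hb false n; have := hb true n.
  move: (act _ (letter q false)) (act _ (letter q true)) => x y yb xb.
  have := rnormD (cmul x (cstar q) + cmul y q - x) (- y).
  have := rnormD (cmul x (cstar q) + cmul y q) (- x).
  have := rnormD (cmul x (cstar q)) (cmul y q).
  have c1 : rnorm (cmul x (cstar q)) <= theta ^+ n * r * r.
    by rewrite (le_trans (rnormM _ _))// ler_pM ?rnorm_ge0 ?rnorm_cstar.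
  have c2 : rnorm (cmul y q) <= theta ^+ n * r * r.
    by rewrite (le_trans (rnormM _ _))// ler_pM ?rnorm_ge0.
  by rewrite !rnormN; lra.
have : rho <= theta.
  apply: (@power_root_le _ _ _ (2 * r * r + 2 * r) 1) => // j n nj n1.
  rewrite /rho -rnorm_idem_center nj -(rnorm_apow _ idem_center_star) -nj subn1.
  rewrite (le_trans (hq _))// [leRHS]mulrAC ler_peMr ?ler1n//.
  by rewrite mulr_ge0 ?exprn_ge0// addr_ge0// !mulr_ge0.
rewrite ler_pdivlMr// => le.
have [rho1|rho1] := eqVneq rho 0; first by rewrite rho1; nra.
have : 0 < rho by rewrite lt_neqAle eq_sym rho1.
move: (r ^+ 2) le => s le; nra.
Qed.

End IdempotentNorm.

(** * Comparison of norms of *-polynomials *)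

Section StarTerms.
Variable R : realType.

(** Formal *-polynomials without constant term, the star being pushed to the variable; zero is
    available as [SLin (-1) s s]. *)
Inductive sterm : Type :=
| SVar
| SVarStar
| SLin (l : R[i]) (s t : sterm)
| SMul (s t : sterm).

Fixpoint steval (A : cstarAlgType R) (q : A) (t : sterm) : A :=
  match t with
  | SVar => q
  | SVarStar => cstar q
  | SLin l s t => l *: steval q s + steval q t
  | SMul s t => cmul (steval q s) (steval q t)
  end.

Fixpoint sstar (t : sterm) : sterm :=
  match t with
  | SVar => SVarStar
  | SVarStar => SVar
  | SLin l s t => SLin l^* (sstar s) (sstar t)
  | SMul s t => SMul (sstar t) (sstar s)
  end.

Fixpoint spow (t : sterm) n := if n is n'.+1 then SMul (spow t n') t else t.

(** Bounds the degree of the normal-form coefficients in the central element, not the word length; a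
    product may add one factor [1 + 'X]. *)
Fixpoint sdeg (t : sterm) : nat :=
  match t with
  | SLin _ s t => maxn (sdeg s) (sdeg t)
  | SMul s t => (sdeg s + sdeg t).+1
  | _ => 0
  end.

(* The power of [1 + idem_center q] in the product of [word a b] and
   [word c d]. *)
Definition crossings (a b c d : bool) : nat :=
  ((a != b) + (b != c) + (c != d))./2.

(** The coefficient of [word a d] in the normal form of [t], as a polynomial in the central element.
    It depends on [t] alone and so serves all idempotents at once. *)
Fixpoint snf (t : sterm) (a d : bool) : {poly R[i]} :=
  match t with
  | SVar => (~~ a && ~~ d)%:R
  | SVarStar => (a && d)%:R
  | SLin l s t => l *: snf s a d + snf t a d
  | SMul s t => \sum_(b : bool) \sum_(c : bool)
      snf s a b * snf t c d * (1 + 'X) ^+ crossings a b c d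
  end.

(** Enclosing [t] between the letters [a] and [d] leaves a multiple of the single word [word a d];
    this is its coefficient. *)
Definition sandwich (t : sterm) (a d : bool) : {poly R[i]} :=
  \sum_(b : bool) \sum_(c : bool)
    snf t b c * (1 + 'X) ^+ (crossings a a b c + crossings a c d d).

Lemma crossings_le a b c d : (crossings a b c d <= 1)%N.
Proof. by case: a; case: b; case: c; case: d. Qed.

Lemma size_1DX_exp n : size ((1 + 'X : {poly R[i]}) ^+ n) = n.+1.
Proof. by rewrite addrC -[1]opprK -polyCN size_exp_XsubC. Qed.

Lemma size_sum_le (I : finType) (F : I -> {poly R[i]}) n :
  (forall i, (size (F i) <= n)%N) -> (size (\sum_i F i)%R <= n)%N.
Proof. by move=> Fn; apply: (leq_trans (size_sum _ _ _)); apply/bigmax_leqP. Qed.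

Lemma size_snf t a d : (size (snf t a d) <= (sdeg t).+1)%N.
Proof.
elim: t a d => [||l s IHs t IHt|s IHs t IHt] a d /=.
- by case: (~~ a && ~~ d); rewrite ?size_poly1 ?size_poly0.
- by case: (a && d); rewrite ?size_poly1 ?size_poly0.
- rewrite (leq_trans (size_polyD _ _))// geq_max.
  rewrite (leq_trans (size_scale_leq _ _)) ?(leq_trans (IHs _ _))//.
    by rewrite (leq_trans (IHt _ _))// ltnS leq_maxr.
  by rewrite ltnS leq_maxl.
- apply: size_sum_le => b; apply: size_sum_le => c.
  rewrite (leq_trans (size_polyMleq _ _))// size_1DX_exp.
  have := size_polyMleq (snf s a b) (snf t c d).
  have := IHs a b; have := IHt c d; have := crossings_le a b c d.
  move: (size _) (size _) (size _) (crossings _ _ _ _) => *; lia.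
Qed.

Lemma size_sandwich t a d : (size (sandwich t a d) <= (sdeg t).+3)%N.
Proof.
apply: size_sum_le => b; apply: size_sum_le => c.
rewrite (leq_trans (size_polyMleq _ _))// size_1DX_exp.
have := size_snf t b c; have := crossings_le a a b c.
have := crossings_le a c d d.
move: (size _) (crossings _ _ _ _) (crossings _ _ _ _) => *; lia.
Qed.

(** Linear growth in [n] is what allows [power_root_le] to absorb the factor [2 N + 1] of the
    polynomial bound. *)
Lemma sdeg_spow t n : ((sdeg (spow t n)).+1 <= n.+1 * (sdeg t).+1)%N.
Proof.
elim: n => [|n IH] /=; rewrite ?mul1n// [leqRHS]mulSn.
by move: (n.+1 * _)%N IH => m; lia.
Qed.

Section Evaluation.
Variables (A : cstarAlgType R) (q : A).

Lemma steval_star t : steval q (sstar t) = cstar (steval q t).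
Proof.
elim: t => [||l s IHs t IHt|s IHs t IHt] //=.
- by rewrite cstarK.
- by rewrite IHs IHt cstarD cstarZ.
- by rewrite IHs IHt cstarM.
Qed.

Lemma steval_spow t n : steval q (spow t n) = apow (steval q t) n.
Proof. by elim: n => [|n IH] /=; rewrite ?apow0// IH apowS. Qed.

Hypothesis qq : cmul q q = q.

Local Notation H := (inA (idem_center q)).
Local Notation W a b := (inA (word q a b)).
Local Notation ev f := (horner_alg H f).

Lemma ev_1DX_exp n : ev ((1 + 'X) ^+ n) = (1 + H) ^+ n.
Proof. by rewrite rmorphXn rmorphD rmorph1 /= horner_algX. Qed.

Lemma ev_word_comm f a b : ev f * W a b = W a b * ev f.
Proof. exact: comm_horner_alg (comm_center_word qq a b). Qed.

Lemma steval_snf t :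
  inA (steval q t) = \sum_(a : bool) \sum_(b : bool) ev (snf t a b) * W a b.
Proof.
elim: t => [||l s IHs t IHt|s IHs t IHt].
- by rewrite !big_bool /= !rmorph0 !rmorph1 !mul0r mul1r !add0r.
- by rewrite !big_bool /= !rmorph0 !rmorph1 !mul0r mul1r !addr0.
- rewrite /= inAD inAZ IHs IHt scaler_sumr -big_split; apply: eq_bigr => a _ /=.
  rewrite scaler_sumr -big_split; apply: eq_bigr => b _ /=.
  by rewrite linearD linearZ /= mulr_algl mulrDl scalerAl.
- rewrite [steval _ _]/= inAM IHs IHt mulr_suml; apply: eq_bigr => a _.
  rewrite mulr_suml.
  transitivity (\sum_(b : bool) \sum_(d : bool) \sum_(c : bool)
      ev (snf s a b * snf t c d * (1 + 'X) ^+ crossings a b c d) * W a d).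
    apply: eq_bigr => b _; rewrite mulr_sumr exchange_big; apply: eq_bigr => c _ /=.
    rewrite mulr_sumr; apply: eq_bigr => d _.
    rewrite !rmorphM /= ev_1DX_exp -mulrA -word_mul//.
    by rewrite -!mulrA; congr (_ * _); rewrite !mulrA ev_word_comm.
  rewrite exchange_big; apply: eq_bigr => d _.
  rewrite /= rmorph_sum mulr_suml; apply: eq_bigr => b _.
  by rewrite rmorph_sum mulr_suml.
Qed.

Lemma sandwichE t a d :
  inA (cmul (cmul (letter q a) (steval q t)) (letter q d)) =
  ev (sandwich t a d) * W a d.
Proof.
have LW b : inA (letter q b) = W b b by rewrite /word eqxx.
rewrite (inAM (cmul _ _)) (inAM (letter _ _)) !LW steval_snf.
rewrite mulr_sumr mulr_suml rmorph_sum mulr_suml.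
apply: eq_bigr => b _; rewrite mulr_sumr mulr_suml rmorph_sum mulr_suml.
apply: eq_bigr => c _ /=; rewrite rmorphM /= ev_1DX_exp exprD.
rewrite mulrA -ev_word_comm -!mulrA; congr (_ * _).
by rewrite mulrA word_mul// -mulrA word_mul.
Qed.

End Evaluation.

End StarTerms.

(** * The norm inequality between two idempotents *)

Section NormComparison.
Variable R : realType.

Local Notation cabs z := (rnorm (z : R[i]^o)).

(* A form of "the spectrum of [idem_center Q] contains [0, r^2 - 1]". *)
Definition full_spectrum (r : R) (A : cstarAlgType R) (Q : A) :=
  forall (f : {poly R[i]}) a b (t : R), 0 <= t <= r ^+ 2 - 1 ->
    cabs f.[t%:C] <=
    rnorm (act (horner_alg (inA (idem_center Q)) f) (word Q a b)).

Lemma cmul_suml (A : cstarAlgType R) (I : Type) (s : seq I) (F : I -> A) (x : A) :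
  cmul (\sum_(i <- s) F i) x = \sum_(i <- s) cmul (F i) x.
Proof.
by elim/big_rec2: _ => [|i y z _ <-]; rewrite ?cmul0r ?cmulDl.
Qed.

Lemma cmul_sumr (A : cstarAlgType R) (I : Type) (s : seq I) (F : I -> A) (x : A) :
  cmul x (\sum_(i <- s) F i) = \sum_(i <- s) cmul x (F i).
Proof.
by elim/big_rec2: _ => [|i y z _ <-]; rewrite ?cmulr0 ?cmulDr.
Qed.

Lemma rnorm_apow_le (A : cstarAlgType R) (T : A) n :
  rnorm (apow T n) <= rnorm T ^+ n.+1.
Proof.
elim: n => [|n IH]; first by rewrite apow0 expr1.
by rewrite apowS exprSr (le_trans (rnormM _ _))// ler_wpM2r ?rnorm_ge0.
Qed.

Section Sandwich.
Variables (A : cstarAlgType R) (q : A).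
Hypothesis qq : cmul q q = q.

Definition block (t : sterm R) a b : A :=
  act (horner_alg (inA (idem_center q)) (snf t a b)) (word q a b).

Lemma steval_block t : steval q t = \sum_(a : bool) \sum_(b : bool) block t a b.
Proof.
apply: inA_inj; rewrite steval_snf// raddf_sum; apply: eq_bigr => a _ /=.
by rewrite raddf_sum; apply: eq_bigr => b _ /=; rewrite /block inA_act.
Qed.

Lemma blockl t a b : cmul (letter q a) (block t a b) = block t a b.
Proof.
apply: inA_inj; rewrite inAM /block inA_act mulrA.
have := ev_word_comm qq (snf t a b) a a; rewrite /word eqxx => <-.
rewrite -mulrA; congr (_ * _).
have := word_mul qq a a a b.
rewrite (_ : _./2 = 0%N); last by rewrite !eqxx; case: (a != b).
by rewrite expr0 mul1r {1}/word eqxx.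
Qed.

Lemma blockr t a b : cmul (block t a b) (letter q b) = block t a b.
Proof.
apply: inA_inj; rewrite inAM /block inA_act -mulrA; congr (_ * _).
have := word_mul qq a b b b.
rewrite (_ : _./2 = 0%N); last by rewrite !eqxx; case: (a != b).
by rewrite expr0 mul1r {2}/word eqxx.
Qed.

(** Each block is fixed by its outer letters, so in a product of block, [x] and block the element
    [x] can be placed between two letters, where [K] applies. *)
Lemma sandwich_bound t x (K : R) :
  (forall a b, rnorm (cmul (cmul (letter q a) x) (letter q b)) <= K) ->
  rnorm (cmul (cmul (steval q t) x) (steval q t)) <=
  (\sum_(a : bool) \sum_(b : bool) rnorm (block t a b)) ^+ 2 * K.
Proof.
move=> xK.
rewrite {1}steval_block cmul_suml cmul_suml (le_trans (rnorm_sum _ _ _))//.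
rewrite expr2 -mulrA mulr_suml; apply: ler_sum => a _.
rewrite !cmul_suml (le_trans (rnorm_sum _ _ _))// mulr_suml.
apply: ler_sum => b _.
rewrite steval_block cmul_sumr (le_trans (rnorm_sum _ _ _))//.
rewrite mulr_suml mulr_sumr; apply: ler_sum => c _.
rewrite cmul_sumr (le_trans (rnorm_sum _ _ _))// mulr_suml mulr_sumr.
apply: ler_sum => d _.
rewrite -(blockr t a b) -{1}(blockl t c d) -[cmul (cmul _ _) x]cmulA.
rewrite -(cmulA (block t a b)) (cmulA _ (letter q c)).
rewrite (le_trans (rnormM _ _))// blockr ler_wpM2l ?rnorm_ge0//.
by rewrite (le_trans (rnormM _ _))// mulrC ler_wpM2l ?rnorm_ge0.
Qed.

End Sandwich.

(** For [T = p^* p], write [T^n = T T^(n - 2) T]. Between two letters the middle power is one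
    polynomial in the central element times one word: its norm at [q] is controlled by the supremum
    of the polynomial, and the full spectrum of [Q] bounds this supremum by the norm at [Q]. *)
Lemma steval_norm_le (r : R) (A B : cstarAlgType R) (q : A) (Q : B) :
  1 <= r -> cmul q q = q -> rnorm q <= r ->
  cmul Q Q = Q -> rnorm Q <= r -> full_spectrum r Q ->
  forall p, rnorm (steval q p) <= rnorm (steval Q p).
Proof.
move=> r1 qq qr QQ Qr specQ p.
have r0 : 0 <= r := le_trans ler01 r1.
rewrite -(@ler_pXn2r _ 2) ?nnegrE ?rnorm_ge0// -!rnorm_star -!steval_star.
pose T := SMul (sstar p) p.
rewrite -[cmul _ _]/(steval q T) -[cmul _ _]/(steval Q T).
have sT : cstar (steval q T) = steval q T.
  by rewrite /= steval_star cstarM cstarK.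
set M := rnorm (steval Q T); have M0 : 0 <= M by exact: rnorm_ge0.
pose X := \sum_(a : bool) \sum_(b : bool) rnorm (block q T a b).
pose D : R := (sdeg T).+1%:R.
have D0 : 1 <= D by rewrite ler1n.
have r21 : 0 <= r ^+ 2 - 1 by rewrite subr_ge0 expr_ge1.
have [s0 sE] : 0 <= Num.sqrt (r ^+ 2 - 1) /\ Num.sqrt (r ^+ 2 - 1) ^+ 2 = r ^+ 2 - 1.
  by rewrite sqrtr_ge0 sqr_sqrtr.
have ks : rnorm (idem_im q) <= Num.sqrt (r ^+ 2 - 1).
  by rewrite -(@ler_pXn2r _ 2) ?nnegrE ?rnorm_ge0// sE rnorm_idem_im.
have letr (C : cstarAlgType R) (c : C) a : rnorm c <= r -> rnorm (letter c a) <= r.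
  by rewrite rnorm_letter.
(* The factor [7 * D * n.+1] dominates [2 N + 1] for the degree bound [N = sdeg + 2] of the
   sandwich; one [r ^+ 2] comes from the two letters at [Q], the other from the word at [q]. *)
have sand n a b :
    rnorm (cmul (cmul (letter q a) (steval q (spow T n))) (letter q b)) <=
    7 * D * n.+1%:R * r ^+ 4 * M ^+ n.+1.
  have fB t : 0 <= t <= Num.sqrt (r ^+ 2 - 1) ^+ 2 ->
      cabs (sandwich (spow T n) a b).[t%:C] <= r ^+ 2 * M ^+ n.+1.
    rewrite sE => /(specQ (sandwich (spow T n) a b) a b) /le_trans; apply.
    have -> : act (horner_alg (inA (idem_center Q)) (sandwich (spow T n) a b))
      (word Q a b) = cmul (cmul (letter Q a) (steval Q (spow T n))) (letter Q b).
      by apply: inA_inj; rewrite inA_act sandwichE.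
    rewrite (le_trans (rnormM _ _))// expr2 mulrAC.
    rewrite ler_pM ?rnorm_ge0 ?letr// (le_trans (rnormM _ _))//.
    by rewrite ler_pM ?rnorm_ge0 ?letr// steval_spow rnorm_apow_le.
  have -> : cmul (cmul (letter q a) (steval q (spow T n))) (letter q b) =
      act (horner_alg (inA (idem_center q)) (sandwich (spow T n) a b)) (word q a b).
    by apply: inA_inj; rewrite inA_act sandwichE.
  rewrite (le_trans (act_polynomial_bound _ (idem_im_star q) ks
    (size_sandwich _ _ _) fB))//.
  rewrite (@le_trans _ _ (7 * D * n.+1%:R * (r ^+ 2 * M ^+ n.+1) * r ^+ 2))//.
    rewrite ler_pM ?rnorm_ge0 ?rnorm_word ?mulr_ge0 ?exprn_ge0//.
    rewrite ler_wpM2r ?mulr_ge0 ?exprn_ge0//.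
    rewrite /D -!natrM ler_nat.
    by have := sdeg_spow T n; move: (sdeg (spow T n)) => d; lia.
  by rewrite le_eqVlt (_ : 4 = 2 + 2)%N// exprD; apply/orP; left; apply/eqP; ring.
(* With [m = n - 3], [spow T m] is the middle power [T^(n - 2)]. One of its [n - 2] factors [M] is
   moved into the constant, which leaves the gap [3]. *)
apply: (@power_root_le _ _ _ (X ^+ 2 * (7 * D * r ^+ 4) * M) 3) => //.
  exact: rnorm_ge0.
move=> j n nj n3; have nE : (n - 3).+3 = n by rewrite -addn3 subnK.
rewrite nj -(rnorm_apow _ sT) -nj -{1}nE; set m := (n - 3)%N.
have -> : apow (steval q T) m.+3.-1 =
    cmul (cmul (steval q T) (steval q (spow T m))) (steval q T).
  apply: inA_inj; rewrite (inAM (cmul _ _)) (inAM (steval q T)) steval_spow.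
  by rewrite !inA_apow -exprS -exprSr.
rewrite (le_trans (sandwich_bound qq _ (sand m)))// -/X.
rewrite (_ : X ^+ 2 * _ = X ^+ 2 * (7 * D * r ^+ 4) * M * m.+1%:R * M ^+ m); last first.
  by rewrite [M ^+ m.+1]exprS; ring.
have X0 : 0 <= X by apply: sumr_ge0 => a _; apply: sumr_ge0 => b _; exact: rnorm_ge0.
have C0 : 0 <= X ^+ 2 * (7 * D * r ^+ 4) * M.
  by rewrite !mulr_ge0 ?exprn_ge0// (le_trans ler01).
by rewrite ler_wpM2r ?exprn_ge0// ler_wpM2l// ler_nat -nE -/m; lia.
Qed.

End NormComparison.

(** * From norm inequalities to universality *)

Section Universality.
Variable R : realType.

Lemma nbhs_rnormP (V : normedModType R[i]) (x : V) (B : set V) :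
  nbhs x B <-> exists2 e : R, 0 < e & forall y, rnorm (x - y) < e -> B y.
Proof.
split=> [/nbhs_ballP[e /= e0 eB]|[e e0 eB]].
  have ee : (complex.Re e)%:C = e by rewrite RRe_real// gtr0_real.
  exists (complex.Re e); first by rewrite -ltcR ee.
  by move=> y xy; apply: eB; rewrite -ball_normE /= rnormE -ee ltcR.
have /rcvgP -/(_ _ e0) : y @[y --> x] --> x by exact: cvg_id.
exact: filterS.
Qed.

Lemma closed_rnormP (V : normedModType R[i]) (S : set V) :
  closed S <->
  forall x, (forall e : R, 0 < e -> exists2 y, S y & rnorm (x - y) < e) -> S x.
Proof.
split=> h x xS; apply: h.
  move=> B /nbhs_rnormP[e e0 eB].
  by have [y Sy xy] := xS _ e0; exists y; split=> //; exact: eB.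
move=> e e0; have [|y [Sy xy]] := xS [set y | rnorm (x - y) < e].
  by apply/nbhs_rnormP; exists e.
by exists y.
Qed.

Section Graph.
Variables (A B : cstarAlgType R) (Q : A) (Q' : B).
Hypothesis norm_le : forall p, rnorm (steval Q' p) <= rnorm (steval Q p).

(** The closure of the set of pairs [(p(Q), p(Q'))]; under the norm inequality it is the graph of
    the desired homomorphism. *)
Definition graph (a : A) (b : B) := forall e : R, 0 < e ->
  exists p, rnorm (a - steval Q p) < e /\ rnorm (b - steval Q' p) < e.

Lemma graph_steval p : graph (steval Q p) (steval Q' p).
Proof. by move=> e e0; exists p; rewrite !subrr !rnorm0. Qed.

Lemma graph_le a b : graph a b -> rnorm b <= rnorm a.
Proof.
move=> ab; apply/ler_addgt0Pr => e e0.
have [|p [ap bp]] := ab (e / 2); first by rewrite divr_gt0.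
have := rnormD (b - steval Q' p) (steval Q' p); rewrite subrK.
have := rnormD (steval Q p - a) a; rewrite subrK (rnorm_dist _ a).
have := norm_le p; lra.
Qed.

Lemma graph_lin l a b a' b' : graph a a' -> graph b b' ->
  graph (l *: a + b) (l *: a' + b').
Proof.
move=> aa bb e e0.
pose n := rnorm (l : R[i]^o) + 1.
have n0 : 0 < n by rewrite ltr_wpDl ?rnorm_ge0.
have en0 : 0 < e / 2 / n by rewrite !divr_gt0.
have e20 : 0 < e / 2 by rewrite divr_gt0.
have [p [ap a'p]] := aa _ en0; have [s [bs b's]] := bb _ e20.
have aux (V : normedModType R[i]) (x y z w : V) : rnorm (x - z) < e / 2 / n ->
    rnorm (y - w) < e / 2 -> rnorm (l *: x + y - (l *: z + w)) < e.
  move=> xz yw; rewrite opprD addrACA -scalerBr.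
  rewrite (le_lt_trans (rnormD _ _))// rnormZC.
  have : rnorm (l : R[i]^o) * rnorm (x - z) <= e / 2.
    move: xz; rewrite ltr_pdivlMr// /n => xz.
    have := rnorm_ge0 (x - z); have := rnorm_ge0 (l : R[i]^o); nra.
  by move: yw; lra.
by exists (SLin l p s); split; exact: aux.
Qed.

Lemma graph_mul a b a' b' : graph a a' -> graph b b' ->
  graph (cmul a b) (cmul a' b').
Proof.
move=> aa bb e e0.
pose n := rnorm a + rnorm b + 1.
have := rnorm_ge0 a; have := rnorm_ge0 b => b0 a0.
have n0 : 0 < n by rewrite /n; lra.
pose d := Num.min 1 (e / (2 * n)).
have d0 : 0 < d by rewrite lt_min ltr01 divr_gt0// mulr_gt0.
have d1 : d <= 1 by rewrite ge_min lexx.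
have dn : d * (2 * n) <= e by rewrite -ler_pdivlMr ?mulr_gt0// ge_min lexx orbT.
have aux (C : cstarAlgType R) (x y z w : C) : rnorm x <= rnorm a ->
    rnorm y <= rnorm b -> rnorm (x - z) < d -> rnorm (y - w) < d ->
    rnorm (cmul x y - cmul z w) < e.
  move=> xa yb xz yw.
  have -> : cmul x y - cmul z w = cmul (x - z) y + cmul z (y - w).
    by rewrite cmulBl cmulBr addrA subrK.
  have h := rnormD (cmul (x - z) y) (cmul z (y - w)).
  have h1 := rnormM (x - z) y; have h2 := rnormM z (y - w).
  have h3 := rnormD (z - x) x; rewrite subrK rnorm_dist in h3.
  have c1 : rnorm (x - z) * rnorm y <= d * rnorm b.
    by rewrite ler_pM ?rnorm_ge0// ltW.
  have c2 : rnorm z * rnorm (y - w) <= (rnorm a + 1) * d.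
    by apply: ler_pM; rewrite ?rnorm_ge0 ?(ltW yw)//; lra.
  move: dn; rewrite /n; nra.
have [p [ap a'p]] := aa _ d0; have [s [bs b's]] := bb _ d0.
by exists (SMul p s); split; apply: aux => //; exact: graph_le.
Qed.

Lemma graph_star a a' : graph a a' -> graph (cstar a) (cstar a').
Proof.
move=> aa e e0; have [p [ap a'p]] := aa _ e0.
by exists (sstar p); rewrite !steval_star -!cstarB !rnorm_cstar.
Qed.

Lemma graph_uniq a b c : graph a b -> graph a c -> b = c.
Proof.
move=> ab ac; have /graph_le := graph_lin (-1) ab ac.
rewrite !scaleN1r addNr rnorm0 => h; apply/esym/eqP; rewrite -subr_eq0 addrC.
by apply/eqP/rnorm0_eq0/le_anti; rewrite h rnorm_ge0.
Qed.

(** If the values at [Q] of a sequence of *-polynomials converge, the norm inequality makes the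
    values at [Q'] Cauchy; completeness of [B] supplies the partner. *)
Lemma graph_closure a :
  (forall e : R, 0 < e -> exists2 p, True & rnorm (a - steval Q p) < e) ->
  exists b, graph a b.
Proof.
move=> h; have inv0 n : 0 < n.+1%:R^-1 :> R by rewrite invr_gt0.
pose p n := projT1 (cid2 (h _ (inv0 n))).
have ap n : rnorm (a - steval Q (p n)) < n.+1%:R^-1 by rewrite /p; case: cid2.
have small (e : R) : 0 < e -> exists N, forall n, (N <= n)%N -> n.+1%:R^-1 < e.
  move=> e0; have [N _ Nn] : \forall n \near \oo, n.+1%:R^-1 < e :> R.
    exact: near_infty_natSinv_lt (PosNum e0).
  by exists N => n /Nn.
have dist m n : rnorm (steval Q' (p m) - steval Q' (p n)) <=
    m.+1%:R^-1 + n.+1%:R^-1.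
  have := norm_le (SLin (-1) (p n) (p m)); rewrite /= !scaleN1r ![- _ + _]addrC.
  move=> /le_trans; apply; rewrite -(subrKA a) (le_trans (rnormD _ _))//.
  by rewrite lerD ?(ltW (ap _))// rnorm_dist ltW.
have cu : cvg ((fun n => steval Q' (p n)) @ \oo).
  apply: cauchy_cvg; apply/rcauchyP => e e0.
  have [|N Nn] := small (e / 2); first by rewrite divr_gt0.
  exists (steval Q' (p N)); exists N => // n /= /Nn n2.
  by rewrite (le_lt_trans (dist _ _))// [e]splitr ltrD// Nn.
exists (lim ((fun n => steval Q' (p n)) @ \oo)) => e e0.
have /rcvgP/(_ _ e0)[N _ Nn] := cu; have [N' N'n] := small _ e0.
exists (p (maxn N N')); split; last by apply: Nn; exact: leq_maxl.
by rewrite (lt_trans (ap _))// N'n// leq_maxr.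
Qed.

(** By minimality, this makes the graph defined on all of [cstar_generated Q]. *)
Lemma graph_subalgebra : cstar_subalgebra [set a | exists b, graph a b].
Proof.
split=> [|l a b [a' aa] [b' bb]|a b [a' aa] [b' bb]|a [a' aa]|].
- exists (steval Q' (SLin (-1) (SVar R) (SVar R))).
  have := graph_steval (SLin (-1) (SVar R) (SVar R)).
  by rewrite /= !scaleN1r !addNr.
- by exists (l *: a' + b'); exact: graph_lin.
- by exists (cmul a' b'); exact: graph_mul.
- by exists (cstar a'); exact: graph_star.
apply/closed_rnormP => a h; apply: graph_closure => e e0.
have e20 : 0 < e / 2 by rewrite divr_gt0.
have [y [b yb] ay] := h _ e20; have [p [yp _]] := yb _ e20.
exists p => //; rewrite -(subrKA y) (le_lt_trans (rnormD _ _))//; lra.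
Qed.

Lemma graph_generated a b : graph a b -> cstar_generated Q' b.
Proof.
move=> ab S [[S0 Sl Sm Ss /closed_rnormP Sc] QS].
have Sp p : S (steval Q' p).
  elim: p => [||l s IHs t IHt|s IHs t IHt] /=.
  - exact: QS.
  - by apply: Ss; exact: QS.
  - exact: Sl.
  - exact: Sm.
apply: Sc => e e0; have [p [_ bp]] := ab _ e0.
by exists (steval Q' p).
Qed.

Lemma generated_hom : exists2 pi : A -> B,
  star_homomorphism (cstar_generated Q) (cstar_generated Q') pi & pi Q = Q'.
Proof.
(* The value [0] off the domain of the graph is arbitrary. *)
pose pi a := if pselect (exists b, graph a b) is left h then projT1 (cid h) else 0.
have piP a b : graph a b -> pi a = b.
  move=> ab; rewrite /pi; case: pselect => [h|[]]; last by exists b.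
  by case: cid => c /= ac; exact: graph_uniq ac ab.
have gen a : cstar_generated Q a -> graph a (pi a).
  move=> Qa; have [b ab] : exists b, graph a b.
    apply: (Qa [set a | exists b, graph a b]); split; first exact: graph_subalgebra.
    by move=> _ ->; exists Q'; exact: (graph_steval (SVar R)).
  by rewrite (piP _ _ ab).
exists pi; last by apply: piP; exact: (graph_steval (SVar R)).
split=> [a /gen|l a b /gen aa /gen bb|a b /gen aa /gen bb|a /gen aa].
- exact: graph_generated.
- by apply: piP; exact: graph_lin.
- by apply: piP; exact: graph_mul.
- by apply: piP; exact: graph_star.
Qed.

End Graph.

Lemma full_spectrum_universal (r : R) (A : cstarAlgType R) (Q : A) : 1 < r ->
  nonprojection_idempotent Q -> rnorm Q = r -> full_spectrum r Q ->
  universal_idempotent r Q.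
Proof.
move=> r1 Qn Qr Qs; split=> //; first by rewrite rnormE Qr.
move=> B Q' [Q'i _]; rewrite rnormE lecR => Q'r; apply: generated_hom => p.
case: Qn => Qi _.
by apply: (@steval_norm_le _ r) => //; [exact: ltW | rewrite Qr].
Qed.

End Universality.

(** * The Hilbert space of square-summable sequences of pairs *)

Section RealSums.
Variable R : realType.
Implicit Types u v : nat -> R.

Definition asummable u := exists M : R, forall n, \sum_(k < n) `|u k| <= M.

Definition rsum u : R := limn (series u).

Lemma series_nondecreasing u : (forall k, 0 <= u k) ->
  {homo series u : m n / (m <= n)%N >-> m <= n}.
Proof. by move=> u0 m n mn; apply: nondecreasing_series mn => k _ _. Qed.

Lemma asummable_cvg u : asummable u -> cvgn (series u).
Proof.
move=> [M uM]; apply: normed_cvg; apply: nondecreasing_is_cvgn.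
  by apply: series_nondecreasing => k; exact: normr_ge0.
by exists M => _ [n _ <-]; rewrite /normed_series_of /series /= big_mkord.
Qed.

Lemma rsumD u v : asummable u -> asummable v ->
  rsum (fun k => u k + v k) = rsum u + rsum v.
Proof.
move=> /asummable_cvg cu /asummable_cvg cv; apply: cvg_lim => //.
rewrite (_ : series _ = series u \+ series v); first exact: cvgD.
by apply/funext => n; rewrite /series /= big_split.
Qed.

Lemma rsumZ (c : R) u : asummable u -> rsum (fun k => c * u k) = c * rsum u.
Proof.
move=> /asummable_cvg cu; apply: cvg_lim => //.
rewrite (_ : series _ = (fun n => c * series u n)); first exact: cvgMl_tmp.
by apply/funext => n; rewrite /series /= mulr_sumr.
Qed.

Lemma rsum_ge_partial u n : (forall k, 0 <= u k) -> asummable u ->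
  \sum_(k < n) u k <= rsum u.
Proof.
move=> u0 /asummable_cvg cu; rewrite -(big_mkord xpredT u).
exact: nondecreasing_cvgn_le (series_nondecreasing u0) cu n.
Qed.

Lemma rsum_le_bound u (M : R) : asummable u ->
  (forall n, \sum_(k < n) u k <= M) -> rsum u <= M.
Proof.
move=> /asummable_cvg cu uM; apply: limr_le => //.
by apply: nearW => n; rewrite seriesEord; exact: uM.
Qed.

Lemma rsum_eventually u N : (forall k, (N <= k)%N -> u k = 0) ->
  rsum u = \sum_(k < N) u k.
Proof.
move=> uN; apply: cvg_lim => //; apply: cvg_near_cst.
exists N => // n /= Nn; rewrite /series /= -(big_mkord xpredT u).
rewrite (big_cat_nat (leq0n N) Nn) /= [X in _ + X]big1_seq ?addr0//.
by move=> k /=; rewrite mem_index_iota => /andP[+ _]; exact: uN.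
Qed.

End RealSums.

Section PairSpace.
Variable R : realType.

Definition c2 : Type := (R[i]^o * R[i]^o)%type.
HB.instance Definition _ := GRing.Lmodule.on c2.
Implicit Types v w : c2.

Definition c2inner v w : R[i] := (v.1 : R[i]) * (w.1 : R[i])^* + (v.2 : R[i]) * (w.2 : R[i])^*.

Definition c2sqr v : R := complex.Re (c2inner v v).

Lemma c2innerDl v v' w : c2inner (v + v') w = c2inner v w + c2inner v' w.
Proof. by rewrite /c2inner /= !mulrDl addrACA. Qed.

Lemma c2innerZl (l : R[i]) v w : c2inner (l *: v) w = l * c2inner v w.
Proof. by rewrite /c2inner /= mulrDr !mulrA. Qed.

Lemma c2innerC v w : c2inner w v = (c2inner v w)^*.
Proof.
by rewrite /c2inner rmorphD !rmorphM /= !conjCK; congr (_ + _); rewrite mulrC.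
Qed.

Lemma c2sqrE v : c2sqr v = (complex.Re v.1) ^+ 2 + (complex.Im v.1) ^+ 2 +
  ((complex.Re v.2) ^+ 2 + (complex.Im v.2) ^+ 2).
Proof. by case: v => [[a b] [c d]]; rewrite /c2sqr /c2inner /=; ring. Qed.

Lemma c2inner_sqr v : c2inner v v = (c2sqr v)%:C.
Proof.
rewrite c2sqrE; case: v => [[a b] [c d]]; rewrite /c2inner /=.
by apply/eqP; rewrite eq_complex /=; apply/andP; split; apply/eqP; ring.
Qed.

Lemma c2sqr_ge0 v : 0 <= c2sqr v.
Proof. by rewrite c2sqrE !addr_ge0 ?sqr_ge0. Qed.

Lemma c2sqr0 v : c2sqr v = 0 -> v = 0.
Proof.
rewrite c2sqrE; case: v => [[a b] [c d]] /= h.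
have : [/\ a ^+ 2 = 0, b ^+ 2 = 0, c ^+ 2 = 0 & d ^+ 2 = 0].
  have := sqr_ge0 a; have := sqr_ge0 b; have := sqr_ge0 c; have := sqr_ge0 d.
  by move: h; split; lra.
case=> /eqP + /eqP + /eqP + /eqP; rewrite !sqrf_eq0.
by move=> /eqP -> /eqP -> /eqP -> /eqP ->.
Qed.

Lemma c2inner_bound v w :
  `|complex.Re (c2inner v w)| <= c2sqr v + c2sqr w /\
  `|complex.Im (c2inner v w)| <= c2sqr v + c2sqr w.
Proof.
rewrite !c2sqrE; case: v w => [[a b] [c d]] [[a' b'] [c' d']]; rewrite /c2inner /=.
have h (x y : R) : - (x ^+ 2 + y ^+ 2) <= 2 * (x * y) <= x ^+ 2 + y ^+ 2.
  by have := sqr_ge0 (x - y); have := sqr_ge0 (x + y); nra.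
move: (h a a') (h b b') (h c c') (h d d') (h a b') (h b a') (h c d') (h d c').
have := sqr_ge0 a; have := sqr_ge0 b; have := sqr_ge0 c; have := sqr_ge0 d.
have := sqr_ge0 a'; have := sqr_ge0 b'; have := sqr_ge0 c'; have := sqr_ge0 d'.
by rewrite !ler_norml; split; lra.
Qed.

Lemma c2sqrZ (l : R[i]) v : c2sqr (l *: v) = complex.Re `|l| ^+ 2 * c2sqr v.
Proof.
rewrite !c2sqrE normc_def /=; case: l v => [x y] [[a b] [c d]] /=.
by rewrite sqr_sqrtr ?addr_ge0 ?sqr_ge0//; ring.
Qed.

(** Young's inequality: the difference of the two sides is [|t v - w|^2 / t]. A good choice of [t]
    yields the triangle inequality in [l2]. *)
Lemma c2sqrD_le v w (t : R) : 0 < t ->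
  c2sqr (v + w) <= (1 + t) * c2sqr v + (1 + t^-1) * c2sqr w.
Proof.
move=> t0; rewrite !c2sqrE; case: v w => [[a b] [c d]] [[a' b'] [c' d']] /=.
have h (x y : R) : (x + y) ^+ 2 <= (1 + t) * x ^+ 2 + (1 + t^-1) * y ^+ 2.
  rewrite -subr_ge0 [leRHS](_ : _ = t^-1 * (t * x - y) ^+ 2).
    by rewrite mulr_ge0 ?invr_ge0 ?sqr_ge0// ltW.
  by field; rewrite gt_eqF.
move: (h a a') (h b b') (h c c') (h d d'); lra.
Qed.

End PairSpace.

Section L2Space.
Variable R : realType.
Local Notation c2 := (c2 R).

Record l2 := L2 {
  l2_fun :> nat -> c2;
  l2_bounded : exists M : R, forall n, \sum_(k < n) c2sqr (l2_fun k) <= M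
}.

HB.instance Definition _ := gen_eqMixin l2.
HB.instance Definition _ := gen_choiceMixin l2.
Implicit Types f g : l2.

Lemma l2_ext f g : (forall n, f n = g n) -> f = g.
Proof.
case: f g => [f fb] [g gb] /= /funext fg; subst g.
by congr L2; exact: Prop_irrelevance.
Qed.

Definition l2sqr f : R := rsum (fun k => c2sqr (f k)).

Lemma asummable_c2sqr f : asummable (fun k => c2sqr (f k)).
Proof.
have [M fM] := l2_bounded f; exists M => n; rewrite (le_trans _ (fM n))//.
by apply: ler_sum => k _; rewrite ger0_norm ?c2sqr_ge0.
Qed.

Lemma l2sqr_ge f n : \sum_(k < n) c2sqr (f k) <= l2sqr f.
Proof.
by apply: rsum_ge_partial (asummable_c2sqr f) => k; exact: c2sqr_ge0.
Qed.

Lemma l2sqr_ge0 f : 0 <= l2sqr f.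
Proof. by have := l2sqr_ge f 0; rewrite big_ord0. Qed.

Lemma l2sqr_ge_term f n : c2sqr (f n) <= l2sqr f.
Proof.
rewrite (le_trans _ (l2sqr_ge f n.+1))// big_ord_recr /= lerDr.
by apply: sumr_ge0 => k _; exact: c2sqr_ge0.
Qed.

Lemma l2sqr_le f (M : R) : (forall n, \sum_(k < n) c2sqr (f k) <= M) -> l2sqr f <= M.
Proof. exact: rsum_le_bound (asummable_c2sqr f). Qed.

Lemma l2_boundedD f g : exists M : R, forall n,
  \sum_(k < n) c2sqr (f k + g k) <= M.
Proof.
exists (2 * l2sqr f + 2 * l2sqr g) => n.
rewrite (@le_trans _ _ (\sum_(k < n) (2 * c2sqr (f k) + 2 * c2sqr (g k))))//.
  apply: ler_sum => k _; have := c2sqrD_le (f k) (g k) ltr01.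
  by rewrite invr1.
by rewrite big_split /= -!mulr_sumr lerD// ler_wpM2l// l2sqr_ge.
Qed.

Lemma l2_boundedZ (l : R[i]) f : exists M : R, forall n,
  \sum_(k < n) c2sqr (l *: f k) <= M.
Proof.
exists (complex.Re `|l| ^+ 2 * l2sqr f) => n.
under eq_bigr do rewrite c2sqrZ.
by rewrite -mulr_sumr ler_wpM2l ?sqr_ge0// l2sqr_ge.
Qed.

Lemma l2_bounded0 : exists M : R, forall n, \sum_(k < n) c2sqr (0 : c2) <= M.
Proof.
exists 0 => n; rewrite big1// => _ _.
by rewrite c2sqrE /= !expr0n /= !addr0.
Qed.

Definition l2_zero : l2 := @L2 (fun=> 0) l2_bounded0.
Definition l2_add f g : l2 := @L2 (fun k => f k + g k) (l2_boundedD f g).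
Definition l2_scale (l : R[i]) f : l2 := @L2 (fun k => l *: f k) (l2_boundedZ l f).

Fact l2_addA : associative l2_add.
Proof. by move=> ? ? ?; apply: l2_ext => n; exact: addrA. Qed.
Fact l2_addC : commutative l2_add.
Proof. by move=> ? ?; apply: l2_ext => n; exact: addrC. Qed.
Fact l2_add0 : left_id l2_zero l2_add.
Proof. by move=> ?; apply: l2_ext => n; exact: add0r. Qed.
Fact l2_addN : left_inverse l2_zero (l2_scale (-1)) l2_add.
Proof. by move=> f; apply: l2_ext => n; rewrite /= scaleN1r addNr. Qed.

HB.instance Definition _ :=
  GRing.isZmodule.Build l2 l2_addA l2_addC l2_add0 l2_addN.

Fact l2_scaleA a b f : l2_scale a (l2_scale b f) = l2_scale (a * b) f.
Proof. by apply: l2_ext => n; exact: scalerA. Qed.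
Fact l2_scale1 : left_id 1 l2_scale.
Proof. by move=> ?; apply: l2_ext => n; exact: scale1r. Qed.
Fact l2_scaleDr : right_distributive l2_scale +%R.
Proof. by move=> ? ? ?; apply: l2_ext => n; exact: scalerDr. Qed.
Fact l2_scaleDl f : {morph l2_scale^~ f : a b / a + b}.
Proof. by move=> ? ?; apply: l2_ext => n; exact: scalerDl. Qed.

HB.instance Definition _ := GRing.Zmodule_isLmodule.Build R[i] l2
  l2_scaleA l2_scale1 l2_scaleDr l2_scaleDl.

Lemma l2DE f g n : (f + g) n = f n + g n. Proof. by []. Qed.
Lemma l2ZE (l : R[i]) f n : (l *: f) n = l *: f n. Proof. by []. Qed.
Lemma l2NE f n : (- f) n = - f n. Proof. exact: scaleN1r. Qed.
Lemma l2BE f g n : (f - g) n = f n - g n. Proof. by rewrite l2DE l2NE. Qed.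

Definition l2norm f : R := Num.sqrt (l2sqr f).

Lemma l2norm_sqr f : l2norm f ^+ 2 = l2sqr f.
Proof. by rewrite sqr_sqrtr// l2sqr_ge0. Qed.

Lemma l2normD f g : l2norm (f + g) <= l2norm f + l2norm g.
Proof.
apply/ler_addgt0Pr => e e0.
have a0 : 0 <= l2norm f by exact: sqrtr_ge0.
have b0 : 0 <= l2norm g by exact: sqrtr_ge0.
(* The shift by [e / 2] keeps [a] and [b] positive; the choice [t = b / a] makes the right side of
   [c2sqrD_le] add up to [(a + b)^2]. *)
pose a := l2norm f + e / 2; pose b := l2norm g + e / 2.
have a1 : 0 < a by rewrite /a; lra.
have b1 : 0 < b by rewrite /b; lra.
rewrite (_ : _ + e = a + b); last by rewrite /a /b; field.
have ab0 : 0 <= a + b by move: (ltW a1) (ltW b1); exact: addr_ge0.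
rewrite -(@ler_pXn2r _ 2) ?nnegrE ?sqrtr_ge0// l2norm_sqr.
have t0 : 0 < b / a by rewrite divr_gt0.
have -> : (a + b) ^+ 2 = (1 + b / a) * a ^+ 2 + (1 + (b / a)^-1) * b ^+ 2.
  by field; rewrite !gt_eqF.
apply: l2sqr_le => n.
rewrite (@le_trans _ _ (\sum_(k < n)
    ((1 + b / a) * c2sqr (f k) + (1 + (b / a)^-1) * c2sqr (g k))))//.
  by apply: ler_sum => k _; exact: c2sqrD_le.
have p1 : 0 <= 1 + b / a by rewrite addr_ge0// ltW.
have p2 : 0 <= 1 + (b / a)^-1 by rewrite addr_ge0// invr_ge0 ltW.
have le (h : l2) (c : R) : l2norm h <= c -> \sum_(k < n) c2sqr (h k) <= c ^+ 2.
  move=> hc; rewrite (le_trans (l2sqr_ge h n))// -l2norm_sqr.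
  by rewrite ler_pXn2r ?nnegrE ?sqrtr_ge0// (le_trans _ hc)// sqrtr_ge0.
rewrite big_split /= -!mulr_sumr; apply: lerD; rewrite ler_wpM2l// le//.
  by rewrite /a lerDl divr_ge0// ltW.
by rewrite /b lerDl divr_ge0// ltW.
Qed.

Lemma l2normZ (l : R[i]) f : l2norm (l *: f) = complex.Re `|l| * l2norm f.
Proof.
rewrite /l2norm /l2sqr; under eq_fun do rewrite l2ZE c2sqrZ.
rewrite rsumZ; last exact: asummable_c2sqr.
by rewrite sqrtrM ?sqr_ge0// sqrtr_sqr ger0_norm// -ler0c RRe_real// normr_real.
Qed.

Lemma l2norm0_eq0 f : l2norm f = 0 -> f = 0.
Proof.
move=> f0; apply: l2_ext => n; apply: c2sqr0; apply/le_anti.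
by rewrite c2sqr_ge0 andbT (le_trans (l2sqr_ge_term f n))// -l2norm_sqr f0 expr0n.
Qed.

Fact l2_normD f g : (l2norm (f + g))%:C <= (l2norm f)%:C + (l2norm g)%:C.
Proof. by rewrite -rmorphD /= lecR l2normD. Qed.
Fact l2_normZ (l : R[i]) f : (l2norm (l *: f))%:C = `|l| * (l2norm f)%:C.
Proof.
rewrite l2normZ; have {2}-> : `|l| = (complex.Re `|l|)%:C.
  by rewrite RRe_real// normr_real.
by rewrite rmorphM.
Qed.
Fact l2_norm0_eq0 f : (l2norm f)%:C = 0 -> f = 0.
Proof. by move=> /complexI; exact: l2norm0_eq0. Qed.

HB.instance Definition _ :=
  Lmodule_isNormed.Build R[i] l2 l2_normD l2_normZ l2_norm0_eq0.

Lemma l2_rnormE f : rnorm f = l2norm f.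
Proof. by apply: (@complexI R); rewrite -rnormE. Qed.

End L2Space.

Section L2Hilbert.
Variable R : realType.
Local Notation l2 := (l2 R).
Local Notation c2R := (c2 R).
Implicit Types f g : l2.

Lemma rnorm_l2_sqr f : rnorm f ^+ 2 = l2sqr f.
Proof. by rewrite l2_rnormE l2norm_sqr. Qed.

Lemma l2_coord_cvg (F : set_system l2) (phi : c2R -> R) :
  ProperFilter F -> cauchy F -> (forall v w, phi (v - w) = phi v - phi w) ->
  (forall v, phi v ^+ 2 <= c2sqr v) ->
  forall n, cvg ((fun f : l2 => phi (f n)) @ F).
Proof.
move=> FF /rcauchyP Fc phiB phi_le n.
apply: cauchy_cvg; apply/cauchyP => e e0.
have [f Ff] := Fc _ e0; exists (phi (f n)); apply: filterS Ff => g fg.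
rewrite -ball_normE /= -phiB -l2BE (le_lt_trans _ fg)//.
rewrite -(@ler_pXn2r _ 2) ?nnegrE ?rnorm_ge0// real_normK ?num_real//.
by rewrite (le_trans (phi_le _))// rnorm_l2_sqr l2sqr_ge_term.
Qed.

(** A Cauchy filter converges in the four real coordinates of every entry. Bounds on finite partial
    sums pass to this limit, and all partial sums together give convergence in norm. *)
Lemma l2_complete (F : set_system l2) : ProperFilter F -> cauchy F -> cvg F.
Proof.
move=> FF Fc.
pose x1 (v : c2R) := complex.Re v.1; pose x2 (v : c2R) := complex.Im v.1.
pose x3 (v : c2R) := complex.Re v.2; pose x4 (v : c2R) := complex.Im v.2.
have B1 v w : x1 (v - w) = x1 v - x1 w.
  by case: v w => [[? ?] [? ?]] [[? ?] [? ?]].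
have B2 v w : x2 (v - w) = x2 v - x2 w.
  by case: v w => [[? ?] [? ?]] [[? ?] [? ?]].
have B3 v w : x3 (v - w) = x3 v - x3 w.
  by case: v w => [[? ?] [? ?]] [[? ?] [? ?]].
have B4 v w : x4 (v - w) = x4 v - x4 w.
  by case: v w => [[? ?] [? ?]] [[? ?] [? ?]].
have sqrE v : c2sqr v = x1 v ^+ 2 + x2 v ^+ 2 + (x3 v ^+ 2 + x4 v ^+ 2).
  exact: c2sqrE.
have le1 v : [/\ x1 v ^+ 2 <= c2sqr v, x2 v ^+ 2 <= c2sqr v,
    x3 v ^+ 2 <= c2sqr v & x4 v ^+ 2 <= c2sqr v].
  have := sqr_ge0 (x1 v); have := sqr_ge0 (x2 v).
  have := sqr_ge0 (x3 v); have := sqr_ge0 (x4 v).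
  by rewrite sqrE; move: (_ ^+ 2) (_ ^+ 2) (_ ^+ 2) (_ ^+ 2) => *; split; lra.
have cv1 n : cvg ((fun f : l2 => x1 (f n)) @ F).
  by apply: l2_coord_cvg => // v; case: (le1 v).
have cv2 n : cvg ((fun f : l2 => x2 (f n)) @ F).
  by apply: l2_coord_cvg => // v; case: (le1 v).
have cv3 n : cvg ((fun f : l2 => x3 (f n)) @ F).
  by apply: l2_coord_cvg => // v; case: (le1 v).
have cv4 n : cvg ((fun f : l2 => x4 (f n)) @ F).
  by apply: l2_coord_cvg => // v; case: (le1 v).
pose L n : c2R := ((lim ((fun f : l2 => x1 (f n)) @ F) +i* lim ((fun f : l2 => x2 (f n)) @ F)),
   (lim ((fun f : l2 => x3 (f n)) @ F) +i* lim ((fun f : l2 => x4 (f n)) @ F))).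
have sq_cvg (phi : c2R -> R) (l a : R) n : (fun f : l2 => phi (f n)) @ F --> l ->
    (fun f : l2 => (a - phi (f n)) ^+ 2) @ F --> (a - l) ^+ 2.
  move=> h; have h' : (fun f : l2 => a - phi (f n)) @ F --> a - l.
    by apply: cvgB h; exact: cvg_cst.
  by apply: cvgM.
have term_cvg f n : (fun g : l2 => c2sqr (f n - g n)) @ F --> c2sqr (f n - L n).
  rewrite sqrE B1 B2 B3 B4.
  under eq_fun do rewrite sqrE B1 B2 B3 B4.
  by apply: cvgD; apply: cvgD; apply: sq_cvg; [exact: cv1|exact: cv2|exact: cv3|exact: cv4].
have sum_cvg f n : (fun g : l2 => \sum_(k < n) c2sqr (f k - g k)) @ F -->
    \sum_(k < n) c2sqr (f k - L k).
  elim: n => [|n IH].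
    by under eq_fun do rewrite big_ord0; rewrite big_ord0; exact: cvg_cst.
  rewrite big_ord_recr; under eq_fun do rewrite big_ord_recr.
  by apply: cvgD => //; exact: term_cvg.
have near_L (e : R) f : 0 < e -> (\forall g \near F, rnorm (f - g) < e) ->
    forall n, \sum_(k < n) c2sqr (f k - L k) <= e ^+ 2.
  move=> e0 Ff n; rewrite -(cvg_lim _ (sum_cvg f n))//.
  apply: limr_le; first by apply/cvg_ex; eexists; exact: sum_cvg.
  apply: filterS Ff => g fg; have := l2sqr_ge (f - g) n.
  under eq_bigr do rewrite l2BE.
  move=> /le_trans; apply; rewrite -rnorm_l2_sqr ler_pXn2r ?nnegrE ?rnorm_ge0//; exact: ltW.
have /rcauchyP Fc' := Fc.
have [f1 Ff1] := Fc' 1 ltr01.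
have bD : exists M : R, forall n, \sum_(k < n) c2sqr (f1 k - L k) <= M.
  by exists (1 ^+ 2) => n; exact: near_L.
(* The limit is written [f1 - D] because square-summability is known for the difference from a
   nearby [f1], not directly for [L]. *)
pose D : l2 := @L2 R (fun k => f1 k - L k) bD.
suff FL : F --> f1 - D by apply/cvg_ex; exists (f1 - D).
apply/rcvgP => e e0.
have e2 : 0 < e / 2 by rewrite divr_gt0.
have [f Ff] := Fc' _ (divr_gt0 e2 (ltr0Sn _ 1)).
apply: filterS (Ff) => g fg.
rewrite -(subrKA f) (le_lt_trans (rnormD _ _))//.
have : rnorm (f - (f1 - D)) <= e / 2 / 2.
  have e40 : 0 <= e / 2 / 2 by rewrite !divr_ge0// ltW.
  rewrite -(@ler_pXn2r _ 2) ?nnegrE ?rnorm_ge0// rnorm_l2_sqr; apply: l2sqr_le => n.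
  under eq_bigr do rewrite !l2BE /D /= subKr.
  by apply: near_L => //; rewrite !divr_gt0.
rewrite rnorm_dist; lra.
Qed.

HB.instance Definition _ := Uniform_isComplete.Build l2 l2_complete.

Definition l2inner f g : R[i] :=
  rsum (fun k => complex.Re (c2inner (f k) (g k))) +i*
  rsum (fun k => complex.Im (c2inner (f k) (g k))).

Lemma l2inner_summable f g :
  asummable (fun k => complex.Re (c2inner (f k) (g k))) /\
  asummable (fun k => complex.Im (c2inner (f k) (g k))).
Proof.
have le n : \sum_(k < n) (c2sqr (f k) + c2sqr (g k)) <= l2sqr f + l2sqr g.
  by rewrite big_split lerD// l2sqr_ge.
split; exists (l2sqr f + l2sqr g) => n; rewrite (le_trans _ (le n))//;
  by apply: ler_sum => k _; have [] := c2inner_bound (f k) (g k).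
Qed.

Fact l2innerDl f f' g : l2inner (f + f') g = l2inner f g + l2inner f' g.
Proof.
have [s1 s2] := l2inner_summable f g; have [s3 s4] := l2inner_summable f' g.
apply/eqP; rewrite eq_complex /=; apply/andP; split; apply/eqP;
  rewrite -rsumD//; congr rsum; apply/funext => k; rewrite ?l2DE c2innerDl raddfD//.
Qed.

Fact l2innerZl (l : R[i]) f g : l2inner (l *: f) g = l * l2inner f g.
Proof.
have [s1 s2] := l2inner_summable f g.
have sZ (c : R) u : asummable u -> asummable (fun k => c * u k).
  move=> [M uM]; exists (`|c| * M) => n; under eq_bigr do rewrite normrM.
  by rewrite -mulr_sumr ler_wpM2l.
case: l => x y; apply/eqP; rewrite eq_complex /=; apply/andP; split; apply/eqP.
  rewrite -mulNr -!rsumZ// -rsumD; [|exact: sZ..].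
  congr rsum; apply/funext => k; rewrite ?l2ZE c2innerZl.
  by case: c2inner => a b /=; ring.
rewrite -!rsumZ// -rsumD; [|exact: sZ..].
congr rsum; apply/funext => k; rewrite ?l2ZE c2innerZl.
by case: c2inner => a b /=; ring.
Qed.

Fact l2innerC f g : l2inner g f = (l2inner f g)^*.
Proof.
have [s1 s2] := l2inner_summable f g.
apply/eqP; rewrite eq_complex /=; apply/andP; split; apply/eqP.
  by congr rsum; apply/funext => k; rewrite c2innerC; case: c2inner.
rewrite -mulN1r -rsumZ//; congr rsum; apply/funext => k.
by rewrite c2innerC mulN1r; case: c2inner.
Qed.

Fact l2inner_norm f : l2inner f f = `|f| ^+ 2.
Proof.
rewrite rnormE -rmorphXn /= rnorm_l2_sqr; apply/eqP; rewrite eq_complex /= eqxx /=.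
apply/eqP; rewrite (rsum_eventually (N := 0)) ?big_ord0// => k _.
by rewrite c2inner_sqr.
Qed.

HB.instance Definition _ := CompleteNormedModule_isHilbert.Build R l2
  l2innerDl l2innerZl l2innerC l2inner_norm.

End L2Hilbert.

(** * Diagonal operators and the model idempotents *)

Section Diagonal.
Variable R : realType.
Local Notation l2 := (l2 R).
Local Notation c2R := (c2 R).
Implicit Types f g : l2.

Lemma rsum_single (u : nat -> R) n : (forall k, k != n -> u k = 0) -> rsum u = u n.
Proof.
move=> un; rewrite (rsum_eventually (N := n.+1)).
  rewrite big_ord_recr /= big1 ?add0r// => k _.
  by rewrite un// ltn_eqF.
by move=> k nk; rewrite un// gtn_eqF.
Qed.

Fact l2_delta_bounded n (v : c2R) : exists M : R, forall m,
  \sum_(k < m) c2sqr (if val k == n then v else 0) <= M.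
Proof.
exists (c2sqr v) => m.
have c0 : c2sqr (0 : c2R) = 0 by rewrite c2sqrE /= expr0n /= !addr0.
have [nm|mn] := ltnP n m.
  rewrite (bigD1 (Ordinal nm))//= eqxx big1 ?addr0// => k.
  by rewrite -val_eqE /= => /negPf ->.
rewrite big1 ?c2sqr_ge0// => k _; rewrite ltn_eqF// (leq_trans (ltn_ord k))//.
Qed.

Definition l2_delta n (v : c2R) : l2 :=
  @L2 R (fun k => if k == n then v else 0) (l2_delta_bounded n v).

Lemma l2_deltaE n v k : l2_delta n v k = if k == n then v else 0.
Proof. by []. Qed.

Lemma rnorm_l2_delta n v : rnorm (l2_delta n v) ^+ 2 = c2sqr v.
Proof.
rewrite rnorm_l2_sqr /l2sqr (rsum_single (n := n)) /= ?eqxx// => k /negPf kn.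
by rewrite kn c2sqrE /= expr0n /= !addr0.
Qed.

Lemma inner_l2_delta n v f : inner (l2_delta n v) f = c2inner v (f n).
Proof.
apply/eqP; rewrite eq_complex /= !(rsum_single (n := n)) /= ?eqxx//.
all: by move=> k /negPf kn; rewrite kn /c2inner /= !mul0r addr0.
Qed.

Variables (m : nat -> c2R -> c2R) (C : R).
Hypotheses (m_linear : forall n, linear (m n)) (C0 : 0 <= C)
  (m_bound : forall n v, c2sqr (m n v) <= C ^+ 2 * c2sqr v).

Fact diag_bounded f : exists M : R, forall n, \sum_(k < n) c2sqr (m k (f k)) <= M.
Proof.
exists (C ^+ 2 * l2sqr f) => n.
rewrite (@le_trans _ _ (\sum_(k < n) C ^+ 2 * c2sqr (f k)))//.
  by apply: ler_sum => k _; exact: m_bound.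
by rewrite -mulr_sumr ler_wpM2l ?sqr_ge0// l2sqr_ge.
Qed.

Definition diag_fun f : l2 := @L2 R (fun k => m k (f k)) (diag_bounded f).

Fact diag_linear : linear diag_fun.
Proof. by move=> l f g; apply: l2_ext => n; exact: m_linear. Qed.

Fact diag_bound f : rnorm (diag_fun f) <= C * rnorm f.
Proof.
rewrite -(@ler_pXn2r _ 2) ?nnegrE ?mulr_ge0 ?rnorm_ge0// exprMn !rnorm_l2_sqr.
apply: l2sqr_le => n; rewrite (@le_trans _ _ (\sum_(k < n) C ^+ 2 * c2sqr (f k)))//.
  by apply: ler_sum => k _; exact: m_bound.
by rewrite -mulr_sumr ler_wpM2l ?sqr_ge0// l2sqr_ge.
Qed.

Definition diag : 'B(l2) := bop_bound diag_linear diag_bound.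

Lemma diagE f n : diag f n = m n (f n). Proof. by []. Qed.

Lemma rnorm_diag : rnorm diag <= C.
Proof. by rewrite bop_rnormE opnorm_le//; exact: diag_bound. Qed.

End Diagonal.

Section OperatorAction.
Variables (R : realType) (K : hilbertType R).
Implicit Types (u : unitz 'B(K)) (x : K) (T : 'B(K)).

(** The unitization also acts on vectors, so that polynomials with a constant term can be evaluated
    on an eigenvector. *)
Definition opact u x : K := u.1 *: x + u.2 x.

Lemma opactM u v x : opact (u * v) x = opact u (opact v x).
Proof.
case: u v => a S [b T]; rewrite /opact /=.
rewrite -[X in _ + X = _]/(a *: T x + b *: S x + S (T x)).
have -> : S (b *: x + T x) = b *: S x + S (T x) by exact: bop_linear.
by rewrite scalerDr scalerA !addrA.
Qed.

Lemma opact_inA T x : opact (inA T) x = T x.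
Proof. by rewrite /opact /= scale0r add0r. Qed.

Lemma opact_eigen u x (l : R[i]) (f : {poly R[i]}) : opact u x = l *: x ->
  opact (horner_alg u f) x = f.[l] *: x.
Proof.
move=> ux; elim/poly_ind: f => [|f c IH].
  by rewrite rmorph0 horner0 /opact /= !scale0r add0r.
rewrite rmorphD rmorphM /= horner_algX horner_algC hornerMXaddC scalerDl -scalerA.
have -> : opact (horner_alg u f * u + c%:A) x =
    opact (horner_alg u f * u) x + c *: x.
  rewrite /opact; set w := _ * u.
  rewrite -[(w + _).2 x]/(w.2 x + c *: 0) -[(w + _).1]/(w.1 + c * 1).
  by rewrite mulr1 scaler0 addr0 scalerDl addrAC.
congr (_ + _); rewrite opactM ux scalerA mulrC -scalerA -IH.
rewrite /opact scalerDr !scalerA mulrC; congr (_ + _).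
by have := bop_linear (horner_alg u f).2 l x 0; rewrite addr0 => ->; rewrite raddf0 addr0.
Qed.

End OperatorAction.

(** * Universality of the model idempotents *)

Section ModelIdempotent.
Variables (R : realType) (r : R) (t : nat -> R).
Local Notation l2 := (l2 R).
Local Notation c2R := (c2 R).

Definition model_block n (v : c2R) : c2R :=
  ((v.1 : R[i]) + (t n)%:C * (v.2 : R[i]), 0).
Definition model_block_adj n (v : c2R) : c2R := (v.1, (t n)%:C * (v.1 : R[i])).

Fact model_block_linear n : linear (model_block n).
Proof.
move=> l [a b] [c d]; rewrite /model_block; congr pair => /=; last first.
  by rewrite scaler0 addr0.
have h (l' a' b' c' d' x : R[i]) :
  l' * a' + c' + x * (l' * b' + d') = l' * (a' + x * b') + (c' + x * d') by ring.
exact: h.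
Qed.

Fact model_block_adj_linear n : linear (model_block_adj n).
Proof.
move=> l [a b] [c d]; rewrite /model_block_adj; congr pair => /=.
have h (l' a' c' x : R[i]) : x * (l' * a' + c') = l' * (x * a') + x * c' by ring.
exact: h.
Qed.

Hypotheses (r1 : 1 < r) (t_le : forall n, 0 <= t n <= Num.sqrt (r ^+ 2 - 1)).

Lemma t_sqr_le n : 1 + t n ^+ 2 <= r ^+ 2.
Proof.
have /andP[t0 ts] := t_le n.
have r2 : 0 <= r ^+ 2 - 1 by have := r1; nra.
by rewrite -lerBrDl -(sqr_sqrtr r2) ler_pXn2r ?nnegrE ?sqrtr_ge0.
Qed.

Fact model_block_bound n v : c2sqr (model_block n v) <= r ^+ 2 * c2sqr v.
Proof.
rewrite (@le_trans _ _ ((1 + t n ^+ 2) * c2sqr v))//; last first.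
  by rewrite ler_wpM2r ?c2sqr_ge0// t_sqr_le.
rewrite !c2sqrE; case: v => [[a b] [c d]] /=.
have h (x y s : R) : (x + s * y) ^+ 2 <= (1 + s ^+ 2) * (x ^+ 2 + y ^+ 2).
  by have := sqr_ge0 (s * x - y); nra.
have := h a c (t n); have := h b d (t n).
rewrite expr0n /= !mul0r subr0 addr0; lra.
Qed.

Fact model_block_adj_bound n v : c2sqr (model_block_adj n v) <= r ^+ 2 * c2sqr v.
Proof.
rewrite (@le_trans _ _ ((1 + t n ^+ 2) * c2sqr v))//; last first.
  by rewrite ler_wpM2r ?c2sqr_ge0// t_sqr_le.
rewrite !c2sqrE; case: v => [[a b] [c d]] /=.
by rewrite !mul0r subr0 addr0 !exprMn; move: (sqr_ge0 (t n)) (sqr_ge0 c) (sqr_ge0 d); nra.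
Qed.

Let r0 : 0 <= r. Proof. exact: le_trans ler01 (ltW r1). Qed.

Definition model : 'B(l2) := diag model_block_linear r0 model_block_bound.

Definition model_adj : 'B(l2) :=
  diag model_block_adj_linear r0 model_block_adj_bound.

Lemma model_star : cstar (model : 'B(l2)) = model_adj.
Proof.
apply: bop_adj_uniq => f g.
have E k : c2inner (model f k) (g k) = c2inner (f k) (model_adj g k).
  rewrite !diagE /c2inner /model_block /model_block_adj /=.
  by rewrite mul0r addr0 rmorphM /= conj_realC; ring.
by apply/eqP; rewrite eq_complex /=; apply/andP; split; apply/eqP; congr rsum;
  apply/funext => k; rewrite -E.
Qed.

Lemma model_idem : cmul (model : 'B(l2)) model = model.
Proof.
apply: bopP => f; apply: l2_ext => n.
by rewrite /= /model_block /= mulr0 addr0.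
Qed.

Let e n : l2 := l2_delta n (1, 0).

Lemma letter_model_e n b :
  (letter (model : 'B(l2)) b : 'B(l2)) (e n) =
  l2_delta n (1, if b then (t n)%:C else 0).
Proof.
apply: l2_ext => k; case: b; rewrite /letter ?model_star diagE !l2_deltaE.
  case: eqP => [->|_]; first by rewrite /model_block_adj /= mulr1.
  by rewrite /model_block_adj /= mulr0.
case: eqP => [->|_]; rewrite /model_block /= mulr0 ?addr0//.
Qed.

(** A computation with 2x2 blocks; each [t_k^2] thereby becomes an eigenvalue of the central
    element. *)
Lemma center_modelE (f : l2) k :
  (idem_center (model : 'B(l2)) : 'B(l2)) f k = (t k ^+ 2)%:C *: f k.
Proof.
rewrite (idem_center_sum model_idem) model_star.
transitivity (model_block k (model_block_adj k (f k)) +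
  model_block_adj k (model_block k (f k)) - model_block k (f k) -
  model_block_adj k (f k)).
  transitivity ((model (model_adj f) + model_adj (model f) - model f -
    model_adj f : l2) k) => //.
  by rewrite !l2BE l2DE.
case: (f k) => x y; rewrite /model_block /model_block_adj rmorphXn; congr pair => /=.
  have h (x' y' c : R[i]) :
    x' + c * (c * x') + (x' + c * y') - (x' + c * y') - x' = c ^+ 2 * x' by ring.
  exact: h.
have h (x' y' c : R[i]) : 0 + c * (x' + c * y') - 0 - c * x' = c ^+ 2 * y' by ring.
exact: h.
Qed.

Lemma center_model_e n :
  (idem_center (model : 'B(l2)) : 'B(l2)) (e n) = (t n ^+ 2)%:C *: e n.
Proof.
apply: l2_ext => k; rewrite center_modelE l2ZE l2_deltaE.
by case: eqP => [->//|_]; rewrite !scaler0.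
Qed.

(** In block [n] the first coordinate of the image is [1], or [1 + t_n^2] for the word [q q^*]. A
    lower bound independent of the word lets [e n] detect [f(t_n^2)] for all of them. *)
Lemma word_model_ge n a b :
  1 <= rnorm ((word (model : 'B(l2)) a b : 'B(l2)) (e n)).
Proof.
rewrite -(@ler_pXn2r _ 2) ?nnegrE ?rnorm_ge0// expr1n rnorm_l2_sqr.
apply: (le_trans _ (l2sqr_ge_term _ n)); rewrite c2sqrE.
suff -> : ((word (model : 'B(l2)) a b : 'B(l2)) (e n) n).1 =
    (if ~~ a && b then 1 + t n ^+ 2 else 1)%:C.
  have := sqr_ge0 (t n); case: ifP => _ /= tn; rewrite expr0n /=;
  by rewrite ?expr1n addr0 ?lerDl ?addr_ge0 ?sqr_ge0//; have := sqr_ge0; nra.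
rewrite /word; case: eqP => [->|ab].
  by rewrite letter_model_e l2_deltaE eqxx; case: b.
transitivity (((letter (model : 'B(l2)) a : 'B(l2))
  ((letter (model : 'B(l2)) b : 'B(l2)) (e n)) n).1) => //.
rewrite letter_model_e; case: a b ab => [] [] // _;
  rewrite /letter ?model_star diagE l2_deltaE eqxx //=.
by rewrite -rmorphM -rmorphD expr2.
Qed.

Hypothesis t_dense : forall tau d : R, 0 <= tau <= Num.sqrt (r ^+ 2 - 1) ->
  0 < d -> exists n, `|tau - t n| < d.

(** On [e n] the operator acts as [f(t_n^2)] times the word, so its norm dominates [|f(t_n^2)|];
    density of the [t_n] and continuity of [f] reach the remaining points. *)
Lemma model_full_spectrum : full_spectrum r (model : 'B(l2)).
Proof.
move=> f a b x /andP[x0 xr].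
set T : 'B(l2) := act _ _.
have fT n : rnorm (f.[(t n ^+ 2)%:C] : R[i]^o) <= rnorm T.
  have TE : T (e n) = f.[(t n ^+ 2)%:C] *: (word (model : 'B(l2)) a b : 'B(l2)) (e n).
    rewrite -opact_inA inA_act ev_word_comm; last exact: model_idem.
    rewrite opactM opact_inA (@opact_eigen _ _ _ _ (t n ^+ 2)%:C).
      exact: linearZ.
    by rewrite opact_inA center_model_e.
  have e1 : rnorm (e n) = 1.
    apply/eqP; rewrite -(@eqrXn2 _ 2) ?rnorm_ge0// rnorm_l2_delta expr1n.
    by rewrite c2sqrE /= expr0n expr1n /= !addr0.
  have := opnorm_apply T (e n); rewrite -bop_rnormE e1 mulr1; apply: le_trans.
  by rewrite TE rnormZC ler_peMr ?rnorm_ge0// word_model_ge.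
have s0 := sqrtr_ge0 (r ^+ 2 - 1).
have r2 : 0 <= r ^+ 2 - 1 by exact: le_trans xr.
set s := Num.sqrt (r ^+ 2 - 1) in s0 *.
have sE : s ^+ 2 = r ^+ 2 - 1 by rewrite sqr_sqrtr.
have [L L0 fL] := poly_lipschitz f (s ^+ 2).
apply/ler_addgt0Pr => d d0.
(* Density is applied at [sqrt x], and [|x - t_n^2| <= 2 s |sqrt x - t_n|]; the added [1] keeps [c]
   positive. *)
pose c := L * (2 * s) + 1.
have c0 : 0 < c by rewrite ltr_wpDl// mulr_ge0// mulr_ge0.
have taus : 0 <= Num.sqrt x <= s by rewrite sqrtr_ge0 ler_sqrt.
have [n tn] := t_dense taus (divr_gt0 d0 c0).
have /andP[tn0 tns] := t_le n.
have tnn : 0 <= t n ^+ 2 <= s ^+ 2 by rewrite sqr_ge0 ler_pXn2r// nnegrE.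
have xs : 0 <= x <= s ^+ 2 by rewrite x0 sE.
rewrite -[f.[x%:C]](subrK f.[(t n ^+ 2)%:C]) (le_trans (@rnormD _ R[i]^o _ _))//.
rewrite [leLHS]addrC; apply: lerD (fT n) _; rewrite (le_trans (fL _ _ xs tnn))//.
rewrite -{1}(sqr_sqrtr x0) subr_sqr normrM.
move: tn; rewrite ltr_pdivlMr// => tn.
have h : `|Num.sqrt x + t n| <= 2 * s.
  by rewrite ger0_norm ?addr_ge0 ?sqrtr_ge0//; case/andP: taus; move: tns; rewrite -/s; lra.
have h1 : L * (`|Num.sqrt x - t n| * `|Num.sqrt x + t n|) <=
    `|Num.sqrt x - t n| * (L * (2 * s)).
  by rewrite mulrCA ler_wpM2l// ler_wpM2l.
by rewrite (le_trans h1)// (le_trans _ (ltW tn))// /c mulrDr mulr1 lerDl.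
Qed.

Hypothesis t_max : exists n, t n = Num.sqrt (r ^+ 2 - 1).

Lemma rnorm_model : rnorm (model : 'B(l2)) = r.
Proof.
apply/le_anti; rewrite rnorm_diag /=; have [n tn] := t_max.
have r2 : 0 <= r ^+ 2 - 1 by have := r1; nra.
have tE : t n ^+ 2 = r ^+ 2 - 1 by rewrite tn sqr_sqrtr.
(* A vector attaining the norm: its length is [sqrt (1 + t_n^2) = r], its image is [r^2 e_n]. *)
pose g : l2 := l2_delta n (1, (t n)%:C).
have gE : rnorm g = r.
  apply/eqP; rewrite -(@eqrXn2 _ 2) ?rnorm_ge0// rnorm_l2_delta.
  by rewrite c2sqrE /= expr0n expr1n /= !addr0 tE addrC subrK.
have := opnorm_apply model g; rewrite -bop_rnormE gE.
have -> : model g = (r ^+ 2)%:C *: e n.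
  apply: l2_ext => k; rewrite diagE l2ZE !l2_deltaE.
  case: eqP => [->|_]; last by rewrite /model_block /= mulr0 addr0 scaler0.
  rewrite /model_block; congr pair; rewrite /= ?scaler0//.
  rewrite -rmorphM -expr2 tE -[RHS]/(_ * 1) mulr1.
  by rewrite -(rmorph1 (@real_complex R)) -rmorphD /= addrC subrK.
rewrite rnormZ ger0_norm ?exprn_ge0//.
have -> : rnorm (e n) = 1.
  apply/eqP; rewrite -(@eqrXn2 _ 2) ?rnorm_ge0// rnorm_l2_delta expr1n.
  by rewrite c2sqrE /= expr0n expr1n /= !addr0.
by rewrite mulr1 expr2 ler_pM2r// (lt_trans ltr01).
Qed.

Lemma model_universal : universal_idempotent r (model : 'B(l2)).
Proof.
apply: full_spectrum_universal => //.
- split; first exact: model_idem.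
  (* A self-adjoint idempotent would have zero central element, against the eigenvalue
     [t_n^2 = r^2 - 1 > 0]. *)
  move=> [_ sQ]; have [n tn] := t_max.
  have := center_model_e n; rewrite /idem_center /idem_im sQ subrr scaler0 cmul0r.
  move=> /(congr1 (fun f : l2 => complex.Re (f n).1)).
  rewrite l2ZE l2_deltaE eqxx /= mulr0 subr0 mulr1 => /esym/eqP.
  by rewrite expf_eq0 /= tn sqrtr_eq0; have := r1; nra.
- exact: rnorm_model.
- exact: model_full_spectrum.
Qed.

End ModelIdempotent.

(** * Inequivalent parameter sequences *)

Section NonEquivalence.
Variable R : realType.
Local Notation l2 := (l2 R).

(** The invariant is the kernel intersected with the orthogonal complement of the range: in a block
    it is spanned by [(0, 1)] if the parameter vanishes, and is zero otherwise. *)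
Lemma model_not_equivalent (r : R) (t t' : nat -> R) (r1 : 1 < r)
    (t_le : forall n, 0 <= t n <= Num.sqrt (r ^+ 2 - 1))
    (t'_le : forall n, 0 <= t' n <= Num.sqrt (r ^+ 2 - 1)) m :
  (forall n, t n != 0) -> t' m = 0 ->
  ~ unitarily_equivalent (model r1 t_le) (model r1 t'_le).
Proof.
move=> t0 t'm [U [[V UK VK] Uinner] UQ].
pose g : l2 := l2_delta m (0, 1).
have Qg : model r1 t'_le g = 0.
  apply: l2_ext => k; rewrite diagE l2_deltaE.
  case: eqP => [->|_]; rewrite /model_block /= ?t'm ?mulr0 ?mul0r addr0//.
have ortho y : inner (model r1 t'_le y) g = 0.
  rewrite innerC inner_l2_delta diagE /c2inner /model_block /=.
  by rewrite rmorph0 mulr0 mul0r addr0 rmorph0.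
have Qf : model r1 t_le (V g) = 0.
  by rewrite -[LHS]UK UQ VK Qg -{1}(raddf0 U) UK.
have f0 : V g = 0.
  apply: l2_ext => n.
  (* The vector [(1, 0)] in block [n] is fixed by the first model, hence in its range; orthogonality
     kills the first coordinate. *)
  have f1 : (V g n).1 = 0.
    have := Uinner (model r1 t_le (l2_delta n (1, 0))) (V g).
    rewrite UQ VK ortho => /esym.
    have -> : model r1 t_le (l2_delta n (1, 0)) = l2_delta n (1, 0).
      exact: (letter_model_e r1 t_le n false).
    rewrite inner_l2_delta /c2inner /= mul0r addr0 mul1r => /eqP.
    by rewrite conjC_eq0 => /eqP.
  (* The kernel equation now says that [t n] times the second coordinate vanishes, with [t n]
     nonzero. *)
  have := congr1 (fun h : l2 => (h n).1) Qf.
  rewrite diagE /model_block /= f1 add0r => /eqP.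
  rewrite mulf_eq0 fmorph_eq0 (negPf (t0 n)) /= => /eqP f2.
  by rewrite [LHS]surjective_pairing f1 f2.
have := congr1 (fun h : l2 => (h m).2) (VK g).
rewrite f0 raddf0 l2_deltaE eqxx /= => /esym/eqP.
by rewrite oner_eq0.
Qed.

Lemma dense_sequence (s : R) : 0 < s -> exists t : nat -> R,
  [/\ forall n, 0 < t n <= s, exists n, t n = s
    & forall x d, 0 <= x <= s -> 0 < d -> exists n, `|x - t n| < d].
Proof.
move=> s0.
(* Positive fractions truncated at [1]: numerators start at [1], so [0] is avoided, and the pair
   [(0, 0)] yields the value [s]. Numbers coding no pair get the default factor [1]. *)
pose q (p : nat * nat) : R := Num.min 1 (p.1.+1%:R / p.2.+1%:R).
pose t n := s * (if unpickle n is Some p then q p else 1).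
have tE p : t (pickle p) = s * q p by rewrite /t pickleK.
have q01 p : 0 < q p <= 1 by rewrite lt_min ltr01 divr_gt0//= ge_min lexx.
exists t; split=> [n||x d /andP[x0 xs] d0].
- rewrite /t; case: unpickle => [p|]; last by rewrite mulr1 s0 lexx.
  by have /andP[p0 p1] := q01 p; rewrite mulr_gt0//= ler_piMr// ltW.
- exists (pickle (0, 0)%N); rewrite tE /q /= divr1 minxx mulr1//.
(* This makes the mesh [s / j.+1] smaller than [d], while [i] is [x / s * j.+1] rounded down;
   truncation at [1] is harmless since [x <= s]. *)
pose j := Num.bound (s / d).
have jd : s / d < j.+1%:R.
  rewrite (lt_trans (archi_boundP _))// ?ltr_nat//.
  by rewrite divr_ge0// ltW.
have j0 : 0 < j.+1%:R :> R by [].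
pose y := x / s * j.+1%:R.
have y0 : 0 <= y by rewrite mulr_ge0// divr_ge0// ltW.
pose i := Num.truncn y.
have /andP[iy yi] : i%:R <= y < i.+1%:R by exact: truncn_itv.
exists (pickle (i, j)); rewrite tE.
have xE : x = s * (y / j.+1%:R) by rewrite /y mulfK ?gt_eqF// mulrC divfK ?gt_eqF.
have sj : s / j.+1%:R < d by rewrite ltr_pdivrMr// mulrC -ltr_pdivrMr.
have h1 : y / j.+1%:R <= 1 by rewrite /y mulfK ?gt_eqF// ler_pdivrMr// mul1r.
have h2 : y / j.+1%:R <= q (i, j) <= y / j.+1%:R + j.+1%:R^-1.
  rewrite /q /= le_min h1 ler_pM2r ?invr_gt0// (ltW yi)/= ge_min.
  have h3 : i.+1%:R <= y + 1 by rewrite -(natr1 i) lerD2r.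
  by rewrite -[X in _ + X]mul1r -mulrDl ler_pM2r ?invr_gt0// h3 orbT.
rewrite {1}xE -mulrBr normrM (gtr0_norm s0) (le_lt_trans _ sj)// ler_pM2l//.
by rewrite ler_norml; move: h2 => /andP[]; move: (_^-1) (q _) => *; lra.
Qed.

End NonEquivalence.

Theorem theorem3p16 (R : realType) (r : R) (hr : 1 < r) :
  exists (K1 K2 : hilbertType R) (Q1 : 'B(K1)) (Q2 : 'B(K2)),
    [/\ universal_idempotent r Q1,
        universal_idempotent r Q2
      & ~ unitarily_equivalent Q1 Q2].
Proof.
have r2 : 0 < r ^+ 2 - 1 by have := hr; nra.
have s0 : 0 < Num.sqrt (r ^+ 2 - 1) by rewrite sqrtr_gt0.
have [t [t_pos [m tm] t_dense]] := dense_sequence s0.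
(* Prepending [0] keeps the density and the attained maximum, but creates one block with zero
   parameter. *)
pose t' n := if n is n'.+1 then t n' else 0.
have t_le n : 0 <= t n <= Num.sqrt (r ^+ 2 - 1).
  by have /andP[/ltW-> ->] := t_pos n.
have t'_le n : 0 <= t' n <= Num.sqrt (r ^+ 2 - 1).
  by case: n => [|n] /=; [rewrite lexx ltW | exact: t_le].
exists (l2 R), (l2 R), (model hr t_le), (model hr t'_le); split.
- by apply: model_universal => //; exists m.
- apply: model_universal; last by exists m.+1.
  by move=> x d xs d0; have [n xn] := t_dense x d xs d0; exists n.+1.
- apply: (model_not_equivalent (m := 0)) => // n.
  by have /andP[/gt_eqF ->] := t_pos n.
Qed.
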